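(* Let $d\in\mathbb{N}$. If $(x_n)_{n=1}^\infty\subseteq[0,1]^d$ is such that $$\lim_{H\to\infty}\frac1H\sum_{h=1}^H \overline{D}\big((x_{n+h}-x_n)_{n=1}^\infty\big)=0,$$ where differences are taken coordinatewise modulo $1$, then $(x_n)_{n=1}^\infty$ is a wm-sequence.
   Context: Notation: $\mathbb{N}=\{1,2,3,\dots\}$; $m^d$ is Lebesgue measure on $[0,1]^d$. Differences of elements of $[0,1]^d$ are taken coordinatewise modulo $1$. Discrepancy: for $(z_n)_{n=1}^N\subseteq[0,1]^d$, $D_N((z_n)_{n=1}^N)=\sup_{B\in\mathcal{R}}\left|\frac1N|\{1\le n\le N: z_n\in B\}|-m^d(B)\right|$, where $\mathcal{R}$ is the collection of all rectangular prisms (axis-parallel boxes) contained in $[0,1]^d$. For an infinite sequence, $\overline{D}((z_n)_{n=1}^\infty)=\limsup_{N\to\infty}D_N((z_n)_{n=1}^N)$. Permissible triple: for bounded complex sequences $(z_n)_{n=1}^\infty$, $(y_n)_{n=1}^\infty$ and an increasing sequence $(N_q)_{q=1}^\infty\subseteq\mathbb{N}$, the triple $((z_n),(y_n),(N_q))$ is permissible if $\lim_{q\to\infty}\frac1{N_q}\sum_{n=1}^{N_q}c_{n+h}\overline{d_n}$ exists for all integers $h\ge 0$ and all choices $(c_n),(d_n)\in\{(z_n),(y_n)\}$. A bounded complex sequence $(z_n)_{n=1}^\infty$ is nearly weakly mixing if for every permissible triple $((z_n),(y_n),(N_q))$ (with $(y_n)$ any bounded complex sequence) one has $\lim_{H\to\infty}\frac1H\sum_{h=1}^H\lim_{q\to\infty}\left|\frac1{N_q}\sum_{n=1}^{N_q}z_{n+h}\overline{y_n}\right|=0$.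 A sequence $(x_n)_{n=1}^\infty\subseteq[0,1]^d$ is a wm-sequence if for every (complex-valued) $f\in C([0,1]^d)$ with $\int_{[0,1]^d}f\,dm^d=0$ the sequence $(f(x_n))_{n=1}^\infty$ is nearly weakly mixing. *)

(* Defs.v *)
From HB Require Import structures.
From mathcomp Require Import all_boot all_order all_algebra.
From mathcomp Require Import all_classical all_reals all_analysis.
From mathcomp Require Import complex.

Set Implicit Arguments.
Unset Strict Implicit.
Unset Printing Implicit Defensive.

Import Order.TTheory GRing.Theory Num.Theory.
Import numFieldTopology.Exports numFieldNormedType.Exports.

Local Open Scope classical_set_scope.
Local Open Scope ring_scope.
Local Open Scope complex_scope.

(* Sequences (z_n)_{n >= 1} are functions on nat whose value at 0 is irrelevant:
   it affects neither the averages below nor whether a sequence is bounded.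
   Only the sequences (N_q) are indexed from q = 0. *)

(* The topology of R[i] is the one of the modulus. *)
HB.instance Definition _ (R : realType) := NormedModule.copy R[i] R[i]^o.

Section borel_rV.
Context {R : realType} (d : nat).

Let coor (i : 'I_d) (x : 'rV[R]_d) : R := x ord0 i.

Let rV_set0 : g_sigma_preimage coor set0.
Proof. exact: sigma_algebra0. Qed.

Let rV_setC A : g_sigma_preimage coor A -> g_sigma_preimage coor (~` A).
Proof. exact: sigma_algebraC. Qed.

Let rV_bigcup (F : (set 'rV[R]_d)^nat) : (forall i, g_sigma_preimage coor (F i)) ->
  g_sigma_preimage coor (\bigcup_i (F i)).
Proof. exact: sigma_algebra_bigcup. Qed.

(* The sigma-algebra of R^d generated by the coordinates, i.e. the Borel one. *)
HB.instance Definition _ := @isMeasurable.Build default_measure_display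
  'rV[R]_d (g_sigma_preimage coor) rV_set0 rV_setC rV_bigcup.

Lemma measurable_coor (i : 'I_d) :
  measurable_fun [set: 'rV[R]_d] (fun x : 'rV[R]_d => x ord0 i).
Proof.
move=> _ Y mY; rewrite setTI; apply: sub_sigma_algebra => /=.
rewrite -bigcup_seq/=; exists i => /=; first by rewrite mem_index_enum.
by exists Y => //; rewrite setTI.
Qed.

Lemma measurable_fun_rV d1 (T : measurableType d1) (f : T -> 'rV[R]_d) :
  (forall i, measurable_fun [set: T] (fun x => f x ord0 i)) ->
  measurable_fun [set: T] f.
Proof.
move=> mf _ Y; rewrite setTI; move: Y.
rewrite [X in forall Y, X Y -> _](_ : _ = g_sigma_preimage coor)//.
have : g_sigma_preimage coor `<=` [set Y | measurable (f @^-1` Y)].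
  apply: smallest_sub.
    split => /=.
    - by rewrite preimage_set0.
    - by move=> A mA; rewrite setTD preimage_setC; exact: measurableC.
    - by move=> F mF; rewrite preimage_bigcup; exact: bigcupT_measurable.
  rewrite -bigcup_seq/= => A [i _ [B mB <-]] /=.
  rewrite setTI -[X in measurable X]setTI.
  exact: (mf i measurableT B mB).
exact.
Qed.

End borel_rV.

Section lebesgue_rV.
Context {R : realType}.

Definition cons_rV d (p : measurableTypeR R * 'rV[R]_d) : 'rV[R]_d.+1 :=
  \row_i if unlift ord0 i is Some j then p.2 ord0 j else p.1.

Definition behead_rV d (x : 'rV[R]_d.+1) : measurableTypeR R * 'rV[R]_d :=
  (x ord0 ord0, \row_i x ord0 (lift ord0 i)).

Lemma behead_rVK d : cancel (@behead_rV d) (@cons_rV d).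
Proof.
move=> x; apply/rowP => i; rewrite mxE.
by case: (unliftP ord0 i) => [j ->|-> //]; rewrite mxE.
Qed.

Lemma cons_rVK d : cancel (@cons_rV d) (@behead_rV d).
Proof.
move=> [a v]; rewrite /behead_rV mxE unlift_none; congr pair.
by apply/rowP => i; rewrite !mxE liftK.
Qed.

Lemma measurable_cons_rV d :
  measurable_fun [set: measurableTypeR R * 'rV[R]_d] (@cons_rV d).
Proof.
apply: measurable_fun_rV => i; under eq_fun do rewrite mxE.
case: (unlift ord0 i) => [j|]; last exact: measurable_fst.
exact: (measurableT_comp (measurable_coor j) measurable_snd).
Qed.

Lemma measurable_behead_rV d : measurable_fun [set: 'rV[R]_d.+1] (@behead_rV d).
Proof.
apply/measurable_fun_pairP; split; first exact: measurable_coor.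
apply: measurable_fun_rV => i /=.
under eq_fun do rewrite mxE.
exact: measurable_coor.
Qed.

Section step.
Context (d : nat) (m : {sigma_finite_measure set 'rV[R]_d -> \bar R}).

Definition lebesgue_rV_step : set 'rV[R]_d.+1 -> \bar R :=
  pushforward (lebesgue_measure \x m)%E (@cons_rV d).

Let mcons := @measurable_cons_rV d.

Let step0 : lebesgue_rV_step set0 = 0%E.
Proof. exact: measure0. Qed.

Let step_ge0 A : (0 <= lebesgue_rV_step A)%E.
Proof. exact: measure_ge0. Qed.

Let step_sigma_additive : semi_sigma_additive lebesgue_rV_step.
Proof. exact: measure_semi_sigma_additive. Qed.

HB.instance Definition _ := isMeasure.Build _ _ _ lebesgue_rV_step
  step0 step_ge0 step_sigma_additive.

Let step_sigma_finite : sigma_finite setT lebesgue_rV_step.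
Proof.
have /sigma_finiteP[F [TF ndF Foo]] := sigma_finiteT (@lebesgue_measure R).
have /sigma_finiteP[G [TG ndG Goo]] := sigma_finiteT m.
exists (fun n => @behead_rV d @^-1` (F n `*` G n)).
  rewrite -preimage_bigcup -[LHS](preimage_setT (@behead_rV d)); congr (_ @^-1` _).
  rewrite -setXTT TF TG predeqE => -[x y]; split => [[/= [n _ Fnx] [k _ Gky]]|].
    exists (maxn n k) => //; split.
    - by move: x Fnx; exact/subsetPset/ndF/leq_maxl.
    - by move: y Gky; exact/subsetPset/ndG/leq_maxr.
  by move=> [n _ []/= ? ?]; split; exists n.
move=> n; have [? ?] := Foo n; have [? ?] := Goo n.
have mFG : measurable (F n `*` G n) by exact: measurableX.
split; first by rewrite -[X in measurable X]setTI; exact: measurable_behead_rV.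
rewrite /lebesgue_rV_step /pushforward -comp_preimage.
rewrite (_ : _ \o _ = id) ?preimage_id; last by apply/funext => p /=; rewrite cons_rVK.
by rewrite product_measure1E// lte_mul_pinfty// ge0_fin_numE.
Qed.

HB.instance Definition _ := Measure_isSigmaFinite.Build _ _ _ lebesgue_rV_step
  step_sigma_finite.

End step.

(* Lebesgue measure on R^d, as the d-fold product of the one on R. *)
Fixpoint lebesgue_rV d : {sigma_finite_measure set 'rV[R]_d -> \bar R} :=
  if d is d'.+1 then lebesgue_rV_step (lebesgue_rV d') else \d_(0 : 'rV[R]_0).

End lebesgue_rV.

Section discrepancy.
Context {R : realType} {d : nat}.
Implicit Types (x y : 'rV[R]_d) (z : nat -> 'rV[R]_d) (B : set 'rV[R]_d).

Definition unit_cube : set 'rV[R]_d := [set x | forall i, 0 <= x ord0 i <= 1].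

(* The sides are arbitrary intervals: open, closed, half-open, degenerate. *)
Definition is_box B := exists I : 'I_d -> interval R,
  B = [set x | forall i, x ord0 i \in I i].

Definition discrepancy z (N : nat) : R :=
  sup [set `| (\sum_(1 <= n < N.+1 | z n \in B) 1)%N%:R / N%:R
              - fine (lebesgue_rV d B) |
      | B in [set B | is_box B /\ B `<=` unit_cube]].

Definition upper_discrepancy z : R := limn_sup (discrepancy z).

Definition frac_part (a : R) : R := a - (Num.floor a)%:~R.

Definition sub_mod1 x y : 'rV[R]_d :=
  \row_i frac_part (x ord0 i - y ord0 i).

End discrepancy.
Arguments unit_cube {R} d.

Section weak_mixing.
Context {R : realType}.
Implicit Types (c e y z : nat -> R[i]) (N : nat -> nat).

Definition correlation c e (M h : nat) : R[i] :=
  M%:R^-1 * \sum_(1 <= n < M.+1) c (n + h)%N * conjc (e n).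

Definition permissible z y N :=
  [/\ bounded_fun z, bounded_fun y,
      forall q, (0 < N q)%N,
      {homo N : p q / (p < q)%N} &
      forall (h : nat) c e, [set z; y] c -> [set z; y] e ->
        cvgn (fun q => correlation c e (N q) h)].

Definition nearly_weakly_mixing z :=
  bounded_fun z /\
  forall y N, permissible z y N ->
    (fun H : nat => H%:R^-1 * \sum_(1 <= h < H.+1)
       limn (fun q => ComplexField.Normc.normc (correlation z y (N q) h)))
      @ \oo --> (0 : R).

Definition cube_integral d (f : 'rV[R]_d -> R[i]) : R[i] :=
  (\int[lebesgue_rV d]_(x in unit_cube d) complex.Re (f x)) +i*
  (\int[lebesgue_rV d]_(x in unit_cube d) complex.Im (f x)).

Definition wm_sequence d (x : nat -> 'rV[R]_d) :=
  (forall n, (0 < n)%N -> unit_cube d (x n)) /\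
  forall f : 'rV[R]_d -> R[i],
    {within unit_cube d, continuous f} -> cube_integral f = 0 ->
    nearly_weakly_mixing (fun n => f (x n)).

End weak_mixing.

(* Main.v *)
Require Import Defs.
From mathcomp Require Import all_boot all_order all_algebra.
From mathcomp Require Import all_classical all_reals all_analysis.
From mathcomp Require Import measurable_realfun complex.
From mathcomp Require Import zify ring lra.

Set Implicit Arguments.
Unset Strict Implicit.
Unset Printing Implicit Defensive.

Import Order.TTheory GRing.Theory Num.Theory.
Import numFieldTopology.Exports numFieldNormedType.Exports.

Local Open Scope classical_set_scope.
Local Open Scope ring_scope.

(** Characters of the torus turn differences into correlations. If [k] is a nonzero
    frequency and [z n] is the value at [x n] of the character of frequency [k], then
    the product of [z (n + h)] with the conjugate of [z n] is the value of the same
    character at the difference [x (n + h) - x n]. The average of a nontrivial character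
    over a sequence is controlled by the discrepancy of the sequence
    ([char_average_le]), so the hypothesis says that the correlations of [z] with its own
    shifts tend to zero on average over the shift. Van der Corput's inequality
    ([van_der_Corput]) then gives the same for the correlations of [z] with an arbitrary
    bounded sequence ([decorrelated_char]). In particular, taking a constant sequence,
    the means of the characters along [x] tend to zero.

    It remains to pass from characters to a continuous function [f] on the cube with
    integral zero. Such an [f] is not a uniform limit of trigonometric polynomials,
    because it need not agree on opposite faces of the cube; but an approximation in
    mean along the sequence is enough ([decorrelated_approx]). It is obtained by
    averaging the values of [f] at the points of a grid with Fejer weights
    ([fejer_mean_approx]), which approximates [f] away from the boundary; the points
    [x n] near the boundary are few, because a bump function around it is itself a
    trigonometric polynomial with small mean ([mean_bump]). The constant term of the
    approximating polynomial is a Riemann sum of [f], hence small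
    ([riemann_sum_cvg]), and its other terms are multiples of nontrivial characters.

    For permissible triples the correlations are not passed to the limit until the very
    end. In the approximating polynomials each character may fail to have convergent
    correlations along the given lengths, so everything is proved for averages over
    finitely many shifts and all large lengths ([decorrelated]). *)

Local Notation normc := ComplexField.Normc.normc.
Local Notation "x %:C" := (real_complex _ x) (format "x %:C") : ring_scope.

(** * The modulus of a complex number *)

Section modulus.
Context {R : realType}.
Implicit Types z w : R[i].

Lemma normcE z : (normc z)%:C = `|z|.
Proof. by case: z. Qed.

Lemma normc_ge0 z : 0 <= normc z.
Proof. by case: z => a b; exact: sqrtr_ge0. Qed.

Lemma normc_conj z : normc (conjc z) = normc z.
Proof. by case: z => a b /=; rewrite sqrrN. Qed.

Lemma normc_real (a : R) : normc a%:C = `|a|.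
Proof. by rewrite /= expr0n/= addr0 sqrtr_sqr. Qed.

Lemma normc_nat n : normc (n%:R : R[i]) = n%:R.
Proof. by rewrite -(rmorph_nat (real_complex R)) normc_real normr_nat. Qed.

Lemma normc_sqr z : (normc z ^+ 2)%:C = z * conjc z.
Proof. by rewrite rmorphXn/= normcE sqr_normc. Qed.

Lemma normcB z w : normc (z - w) = normc (w - z).
Proof. by apply: complexI; rewrite !normcE distrC. Qed.

Lemma normcB_le z w : normc (z - w) <= normc z + normc w.
Proof. by rewrite -lecR rmorphD/= !normcE ler_normB. Qed.

Lemma normc_sum (I : Type) (r : seq I) (P : pred I) (F : I -> R[i]) :
  normc (\sum_(i <- r | P i) F i) <= \sum_(i <- r | P i) normc (F i).
Proof.
elim/big_rec2: _ => [|i a z _ ih]; first by rewrite ComplexField.Normc.normc0.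
by apply: le_trans (le_normcD _ _) _; rewrite lerD2l.
Qed.

Lemma normc_dist z w : `|normc z - normc w| <= normc (z - w).
Proof.
have tri a b : normc a - normc b <= normc (a - b).
  by rewrite lerBlDr -{1}(subrK b a); exact: le_normcD.
by rewrite ler_norml tri lerNl opprB normcB tri.
Qed.

Lemma conjc_sum (I : Type) (r : seq I) (P : pred I) (F : I -> R[i]) :
  conjc (\sum_(i <- r | P i) F i) = \sum_(i <- r | P i) conjc (F i).
Proof. exact: rmorph_sum. Qed.

Lemma Re_sum (I : Type) (r : seq I) (P : pred I) (F : I -> R[i]) :
  complex.Re (\sum_(i <- r | P i) F i) = \sum_(i <- r | P i) complex.Re (F i).
Proof. exact: (@raddf_sum (Rcomplex R) R (@complex.Re R)). Qed.

Lemma Im_sum (I : Type) (r : seq I) (P : pred I) (F : I -> R[i]) :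
  complex.Im (\sum_(i <- r | P i) F i) = \sum_(i <- r | P i) complex.Im (F i).
Proof. exact: (@raddf_sum (Rcomplex R) R (@complex.Im R)). Qed.

Lemma normc_Re_le z : `|complex.Re z| <= normc z.
Proof. by rewrite -lecR normcE normc_ge_Re. Qed.

Lemma normc_Im_le z : `|complex.Im z| <= normc z.
Proof. by case: z => a b /=; rewrite -sqrtr_sqr ler_sqrt ?addr_ge0 ?sqr_ge0// lerDr sqr_ge0. Qed.

Lemma normc_le_ReIm z : normc z <= `|complex.Re z| + `|complex.Im z|.
Proof.
case: z => a b /=; rewrite -[leRHS]ger0_norm ?addr_ge0// -sqrtr_sqr ler_sqrt ?sqr_ge0//.
rewrite sqrrD !real_normK ?num_real// addrAC lerDl mulrn_wge0// mulr_ge0.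
Qed.

End modulus.

(** * Characters of the torus *)

Section characters.
Context {R : realType}.
Implicit Types (t : R) (d : nat).

Definition cis t : R[i] := (cos t +i* sin t)%C.

Lemma cisD s t : cis (s + t) = cis s * cis t.
Proof. by rewrite /cis cosD sinD; simpc; congr (_ +i* _)%C; rewrite addrC. Qed.

Lemma cis0 : cis 0 = 1.
Proof. by rewrite /cis cos0 sin0. Qed.

Lemma cisN t : cis (- t) = conjc (cis t).
Proof. by rewrite /cis cosN sinN. Qed.

Lemma normc_cis t : normc (cis t) = 1.
Proof. by rewrite /= cos2Dsin2 sqrtr1. Qed.

Lemma cis_natM n t : cis (n%:R * t) = cis t ^+ n.
Proof.
elim: n => [|n ih]; first by rewrite mul0r cis0 expr0.
by rewrite -natr1 mulrDl mul1r cisD ih exprSr.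
Qed.

Lemma cis_sum (I : Type) (r : seq I) (F : I -> R) :
  cis (\sum_(i <- r) F i) = \prod_(i <- r) cis (F i).
Proof. by elim/big_rec2: _ => [|i a z _ <-]; rewrite ?cis0 ?cisD. Qed.

Lemma cis_int (m : int) : cis (2 * pi * m%:~R) = 1.
Proof.
have nat n : cis (2 * pi * n%:R) = 1.
  rewrite mulrC cis_natM /cis mulr_natl cos2pi.
  by rewrite -[pi *+ 2]add0r sinD2pi sin0 expr1n.
case: m => n; first by rewrite -pmulrn nat.
by rewrite NegzE mulrNz mulrN cisN -pmulrn nat conjc1.
Qed.

Definition char d (k : 'I_d -> int) (u : 'rV[R]_d) : R[i] :=
  cis (2 * pi * \sum_i (k i)%:~R * u ord0 i).

Lemma normc_char d (k : 'I_d -> int) u : normc (char k u) = 1.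
Proof. exact: normc_cis. Qed.

Lemma char_conj d (k : 'I_d -> int) u : conjc (char k u) * char k u = 1.
Proof. by rewrite mulrC -normc_sqr normc_char expr1n. Qed.

Lemma charB d (k : 'I_d -> int) u v :
  char k (u - v) = char k u * conjc (char k v).
Proof.
rewrite /char -cisN -cisD -mulrBr -sumrB; congr (cis (_ * _)).
by apply: eq_bigr => i _; rewrite !mxE mulrBr.
Qed.

Lemma charM d (k l : 'I_d -> int) u :
  char (fun i => k i - l i) u = char k u * conjc (char l u).
Proof.
rewrite /char -cisN -cisD -mulrBr -sumrB; congr (cis (_ * _)).
by apply: eq_bigr => i _; rewrite intrB mulrBl.
Qed.

Lemma char_trivial d (k : 'I_d -> int) u : (forall i, k i = 0) -> char k u = 1.
Proof. by move=> k0; rewrite /char big1 ?mulr0 ?cis0// => i _; rewrite k0 mul0r. Qed.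

Lemma char_sub_mod1 d (k : 'I_d -> int) (u v : 'rV[R]_d) :
  char k (sub_mod1 u v) = char k u * conjc (char k v).
Proof.
rewrite -charB; apply/esym.
pose m : int := \sum_i k i * Num.floor (u ord0 i - v ord0 i).
rewrite -[LHS]mulr1 -(cis_int (- m)) /char -cisD -mulrDr; congr (cis (_ * _)).
rewrite mulrNz /m rmorph_sum/= -sumrB; apply: eq_bigr => i _.
by rewrite !mxE /frac_part rmorphM/= !mulrBr.
Qed.

Definition grid_pt d M (j : {ffun 'I_d -> 'I_M}) : 'rV[R]_d :=
  \row_i ((j i)%:R / M%:R).

Lemma cis_eq1 t : cis (2 * pi * t) = 1 -> 0 <= t < 1 -> t = 0.
Proof.
move=> /(congr1 (@complex.Re R))/= c /andP[t0 t1]; apply/eqP; rewrite eq_le t0 andbT leNgt; apply/negP => tp.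
have := pi_gt0 R => pi0.
have s0 : sin (pi * t) != 0.
  by rewrite gt_eqF// sin_gt0_pi// mulr_gt0//= -[ltRHS]mulr1 ltr_pM2l.
move: c s0; rewrite -mulrA mulr_natl cos_mulr2n => c.
have : sin (pi * t) ^+ 2 = 0 by have := cos2Dsin2 (pi * t); lra.
by move/eqP; rewrite expf_eq0/= => /eqP ->; rewrite eqxx.
Qed.

(** Some factor of the product over the coordinates is the sum of all powers of
    an [M]-th root of unity other than [1]. *)
Lemma sum_char_grid d M (k : 'I_d -> int) :
  (exists2 i, k i != 0 & (`|k i| < M)%N) ->
  \sum_(j : {ffun 'I_d -> 'I_M}) char k (grid_pt j) = 0.
Proof.
move=> [i0 ki0 kM]; have M0 : (0 < M)%N by case: M kM.
pose F i (a : 'I_M) : R[i] := cis (2 * pi * ((k i)%:~R * (a%:R / M%:R))).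
transitivity (\sum_(j : {ffun 'I_d -> 'I_M}) \prod_i F i (j i)).
  apply: eq_bigr => j _; rewrite /char mulr_sumr cis_sum; apply: eq_bigr => i _.
  by rewrite mxE.
rewrite -bigA_distr_bigA; apply/eqP/prodf_eq0; exists i0 => //.
pose z := cis (2 * pi * ((k i0)%:~R / M%:R)).
have -> : \sum_j F i0 j = \sum_(a < M) z ^+ a.
  by apply: eq_bigr => a _; rewrite -cis_natM /F; congr cis; ring.
have zM : z ^+ M = 1.
  rewrite -cis_natM -(cis_int (k i0)); congr cis.
  by rewrite mulrCA; congr (_ * _); rewrite mulrC divfK// pnatr_eq0 -lt0n.
have z1 : z - 1 != 0.
  apply: contra ki0; rewrite subr_eq0 => /eqP z1; move: kM z1; rewrite /z.
  have M0' : 0 < M%:R :> R by rewrite ltr0n.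
  have ratio n : (n < M)%N -> cis (2 * pi * (n%:R / M%:R)) = 1 -> n = 0%N.
    move=> nM /cis_eq1; rewrite divr_ge0//= ltr_pdivrMr// mul1r ltr_nat nM.
    by move=> /(_ isT)/eqP; rewrite mulf_eq0 invr_eq0 [M%:R == _]gt_eqF// orbF pnatr_eq0 => /eqP.
  case: (k i0) => n; first by rewrite -pmulrn => nM /ratio -> .
  rewrite NegzE abszN => nM; rewrite mulrNz mulNr mulrN cisN.
  by move=> /(congr1 conjc); rewrite conjcK conjc1 -pmulrn => /ratio-> .
by apply/eqP/(mulfI z1); rewrite -subrX1 zM subrr mulr0.
Qed.

End characters.

Arguments cis {R} t : simpl never.
Arguments char {R d} k u : simpl never.

(** * Boxes and their measure *)

Section boxes.
Context {R : realType}.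
Implicit Types d M : nat.

Lemma measurable_box d (I : 'I_d -> interval R) :
  measurable [set x : 'rV[R]_d | forall i, x ord0 i \in I i].
Proof.
rewrite (_ : mkset _ = \bigcap_(i in [set: 'I_d])
    ((fun x : 'rV[R]_d => x ord0 i) @^-1` [set` I i])).
  apply: fin_bigcap_measurable => // i _.
  by rewrite -[X in measurable X]setTI; apply: measurable_coor => //; exact: measurable_itv.
by apply/seteqP; split => [x xI i _|x xI i]; [exact: xI|exact: (xI i Logic.I)].
Qed.

Lemma lebesgue_box d (a c : 'I_d -> R) (s : 'I_d -> bool) : (forall i, a i <= c i) ->
  lebesgue_rV d [set x | forall i, x ord0 i \in Interval (BLeft (a i)) (BSide (s i) (c i))]
  = (\prod_i (c i - a i))%:E.
Proof.
elim: d a c s => [|d ih] a c s ac.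
  by rewrite big_ord0 /= diracE mem_set// => -[].
rewrite big_ord_recl /= /lebesgue_rV_step /pushforward.
pose S : set (measurableTypeR R * 'rV[R]_d) :=
  [set` Interval (BLeft (a ord0)) (BSide (s ord0) (c ord0))] `*`
  [set x : 'rV[R]_d | forall i : 'I_d, x ord0 i \in Interval (BLeft (a (lift ord0 i)))
      (BSide (s (lift ord0 i)) (c (lift ord0 i)))].
transitivity ((lebesgue_measure \x lebesgue_rV d)%E S).
  congr (_ _).
  apply/seteqP; split => [[t u] /= xI|[t u] /= [tI uI] i].
    split; first by have := xI ord0; rewrite mxE unlift_none.
    by move=> i; have := xI (lift ord0 i); rewrite mxE liftK.
  by rewrite mxE; case: unliftP => [j ->|->].
rewrite /S product_measure1E; [|exact: measurable_itv|exact: measurable_box].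
rewrite ih// EFinM; congr (_ * _)%E; apply: etrans (lebesgue_measure_itv _) _ => /=.
have := ac ord0; rewrite le_eqVlt => /predU1P[->|ac0]; last by rewrite lte_fin ac0.
by rewrite ltxx subrr.
Qed.

Lemma unit_cubeE d : unit_cube d =
  [set x : 'rV[R]_d | forall i, x ord0 i \in Interval (BLeft 0) (BSide false 1)].
Proof. by []. Qed.

Lemma measurable_unit_cube d : measurable (unit_cube d : set 'rV[R]_d).
Proof. by rewrite unit_cubeE; exact: measurable_box. Qed.

Lemma lebesgue_unit_cube d : lebesgue_rV d (unit_cube d : set 'rV[R]_d) = 1%E.
Proof.
rewrite unit_cubeE (lebesgue_box (fun=> false)) => [|i]; last exact: ler01.
by rewrite big1// => i _; rewrite subr0.
Qed.

Lemma lebesgue_box_le1 d (B : set 'rV[R]_d) : is_box B -> B `<=` unit_cube d ->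
  0 <= fine (lebesgue_rV d B) <= 1.
Proof.
move=> [I ->] Bcube; rewrite fine_ge0//= -lee_fin fineK.
  rewrite -(lebesgue_unit_cube d); apply: le_measure => //; rewrite inE//.
    exact: measurable_box.
  exact: measurable_unit_cube.
rewrite ge0_fin_numE// (@le_lt_trans _ _ 1%E) ?ltry//.
rewrite -(lebesgue_unit_cube d); apply: le_measure => //; rewrite inE//.
  exact: measurable_box.
exact: measurable_unit_cube.
Qed.

(** The last cell in each direction is closed, so that the cells partition the
    closed cube. *)
Definition cell_itv M (a : 'I_M) : interval R :=
  Interval (BLeft (a%:R / M%:R)) (BSide (a.+1 < M)%N (a.+1%:R / M%:R)).

Definition cell d M (j : {ffun 'I_d -> 'I_M}) : set 'rV[R]_d :=
  [set x | forall i, x ord0 i \in cell_itv (j i)].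

Definition cell_index d M (x : 'rV[R]_d) : {ffun 'I_d -> 'I_M.+1} :=
  [ffun i => inord (minn (Num.truncn (M.+1%:R * x ord0 i)) M)].

Lemma mem_cell_itv M (a : 'I_M.+1) (t : R) : 0 <= t <= 1 ->
  (t \in cell_itv a) = (a == inord (minn (Num.truncn (M.+1%:R * t)) M)).
Proof.
move=> /andP[t0 t1]; have M0 : 0 < M.+1%:R :> R by rewrite ltr0n.
have Mt0 : 0 <= M.+1%:R * t by rewrite mulr_ge0.
have MtM : M.+1%:R * t <= M.+1%:R by rewrite -[leRHS]mulr1 ler_pM2l.
rewrite in_itv/= ler_pdivrMr// [t * _]mulrC -(truncn_ge_nat _ Mt0).
rewrite -val_eqE/= inordK ?ltnS ?geq_minr//.
have := ltn_ord a; rewrite ltnS leq_eqVlt => /predU1P[aM|aM].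
  rewrite aM ltnn/= ler_pdivlMr// [t * _]mulrC MtM andbT.
  by rewrite /minn; case: ltnP => [h|]; [rewrite gtn_eqF|rewrite eqxx].
rewrite aM/= ltr_pdivlMr// [t * _]mulrC -(truncn_lt_nat _ Mt0) ltnS -eqn_leq.
rewrite /minn; case: ltnP => // h; rewrite !ltn_eqF//.
exact: leq_trans aM h.
Qed.

Lemma mem_cell d M (j : {ffun 'I_d -> 'I_M.+1}) (x : 'rV[R]_d) : unit_cube d x ->
  (x \in cell j) = (cell_index M x == j).
Proof.
move=> xc; apply/idP/eqP => [/set_mem xj|xj].
  apply/ffunP => i; rewrite ffunE; apply/esym/eqP.
  by rewrite -mem_cell_itv ?xc//; exact: xj.
by apply/mem_set => i; rewrite mem_cell_itv ?xc// -xj ffunE.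
Qed.

Lemma cell_index_cell d M (x : 'rV[R]_d) : unit_cube d x -> cell (cell_index M x) x.
Proof. by move=> xc; apply/set_mem; rewrite mem_cell. Qed.

Lemma sub_cell_cube d M (j : {ffun 'I_d -> 'I_M.+1}) : cell j `<=` unit_cube d.
Proof.
move=> x xj i; have := xj i; rewrite in_itv/= => /andP[l r]; apply/andP; split.
  by apply: le_trans l; rewrite divr_ge0.
apply: (@le_trans _ _ ((j i).+1%:R / M.+1%:R)).
  exact: lteifW r.
by rewrite ler_pdivrMr// mul1r ler_nat.
Qed.

Lemma cell_is_box d M (j : {ffun 'I_d -> 'I_M}) : is_box (cell j).
Proof. by exists (fun i => cell_itv (j i)). Qed.

Lemma measurable_cell d M (j : {ffun 'I_d -> 'I_M}) : measurable (cell j).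
Proof. exact: measurable_box. Qed.

Lemma lebesgue_cell d M (j : {ffun 'I_d -> 'I_M.+1}) :
  lebesgue_rV d (cell j) = (M.+1%:R^-1 ^+ d)%:E.
Proof.
rewrite (lebesgue_box (fun i => (j i).+1 < M.+1)%N) => [|i]; last first.
  by rewrite ler_pM2r ?invr_gt0 ?ltr0n// ler_nat.
congr (_%:E); rewrite -[in RHS](card_ord d) -prodr_const; apply: eq_bigr => i _.
by rewrite -mulrBl -natrB// subSnn mul1r.
Qed.

Lemma cell_near d M (j : {ffun 'I_d -> 'I_M.+1}) x : cell j x ->
  forall i, `|x ord0 i - grid_pt j ord0 i| <= M.+1%:R^-1.
Proof.
move=> xj i; have := xj i; rewrite in_itv/= mxE => /andP[l r].
rewrite ger0_norm ?subr_ge0// lerBlDl -[X in _ + X]mul1r -mulrDl natr1.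
exact: lteifW r.
Qed.

Lemma grid_pt_cube d M (j : {ffun 'I_d -> 'I_M}) : unit_cube d (grid_pt j : 'rV[R]_d).
Proof.
move=> i; rewrite mxE; have jM := ltn_ord (j i).
have M0 : (0 < M)%N by apply: leq_ltn_trans jM.
by rewrite divr_ge0//= ler_pdivrMr ?ltr0n// mul1r ler_nat ltnW.
Qed.

Lemma card_cells d M : #|{: {ffun 'I_d -> 'I_M}}| = (M ^ d)%N.
Proof. by rewrite card_ffun !card_ord. Qed.

End boxes.

(** * Discrepancy *)

Section discrepancy_bounds.
Context {R : realType} {d : nat}.
Implicit Types (z : nat -> 'rV[R]_d) (B : set 'rV[R]_d).

Lemma dev_le2 z N B : is_box B -> B `<=` unit_cube d ->
  `| (\sum_(1 <= n < N.+1 | z n \in B) 1)%N%:R / N%:R - fine (lebesgue_rV d B) | <= 2.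
Proof.
move=> bB cB; have /andP[m0 m1] := lebesgue_box_le1 bB cB.
have c0 : 0 <= (\sum_(1 <= n < N.+1 | z n \in B) 1)%N%:R / N%:R :> R by rewrite divr_ge0.
have c1 : (\sum_(1 <= n < N.+1 | z n \in B) 1)%N%:R / N%:R <= 1 :> R.
  case: N {c0} => [|N]; first by rewrite invr0 mulr0.
  rewrite ler_pdivrMr ?ltr0n// mul1r ler_nat.
  apply: (@leq_trans (\sum_(1 <= n < N.+2) 1)); last by rewrite sum_nat_const_nat muln1 subn1.
  by rewrite big_mkcond; apply: leq_sum => n _; case: ifP.
by rewrite ler_norml; apply/andP; split; lra.
Qed.

Lemma discrepancy_has_sup z N :
  has_sup [set `| (\sum_(1 <= n < N.+1 | z n \in B) 1)%N%:R / N%:R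
              - fine (lebesgue_rV d B) |
      | B in [set B | is_box B /\ B `<=` unit_cube d]].
Proof.
split.
  have j : {ffun 'I_d -> 'I_1} by exact: [ffun=> ord0].
  by eexists; exists (cell j) => //; split; [exact: cell_is_box|exact: sub_cell_cube].
by exists 2 => _ [B [bB cB] <-]; exact: dev_le2.
Qed.

Lemma box_dev_le z N B : is_box B -> B `<=` unit_cube d ->
  `| (\sum_(1 <= n < N.+1 | z n \in B) 1)%N%:R / N%:R - fine (lebesgue_rV d B) |
    <= discrepancy z N.
Proof.
move=> bB cB; apply: sup_upper_bound; first exact: discrepancy_has_sup.
by exists B.
Qed.

Lemma discrepancy_le2 z N : 0 <= discrepancy z N <= 2.
Proof.
have j : {ffun 'I_d -> 'I_1} by exact: [ffun=> ord0].
apply/andP; split.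
  by apply: le_trans (box_dev_le z N (cell_is_box j) _) => //; exact: sub_cell_cube.
apply: ge_sup; first by have [] := discrepancy_has_sup z N.
by move=> _ [B [bB cB] <-]; exact: dev_le2.
Qed.

Lemma le_upper_discrepancy z (e : R) : 0 < e ->
  \forall N \near \oo, discrepancy z N <= upper_discrepancy z + e.
Proof.
move=> e0; set u := discrepancy z.
have ub : has_ubound (range u).
  by exists 2 => _ [N _ <-]; have /andP[] := discrepancy_le2 z N.
have lb : has_lbound (range u).
  by exists 0 => _ [N _ <-]; have /andP[] := discrepancy_le2 z N.
have cu := cvg_sups_inf ub lb.
have : upper_discrepancy z < upper_discrepancy z + e by rewrite ltrDl.
rewrite {1}/upper_discrepancy /limn_sup (cvg_lim _ cu)// => lt.
near=> N; apply: (@le_trans _ _ (sups u N)).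
  by apply: ub_le_sup; [exact: has_ubound_sdrop|exists N => /=].
by apply: ltW; near: N; exact: (cvgr_lt _ cu).
Unshelve. all: by end_near. Qed.

End discrepancy_bounds.

(** * Averages of a character *)

Section char_average.
Context {R : realType}.
Implicit Types (d : nat) (e : R).

Lemma cis_near1 e : 0 < e ->
  exists2 r : R, 0 < r & forall t, `|t| < r -> normc (cis t - 1) <= e.
Proof.
move=> e0; have e20 : 0 < e / 2 by rewrite divr_gt0.
have : \forall t \near (0 : R), `|cos 0 - cos t| < e / 2 /\ `|sin 0 - sin t| < e / 2.
  near=> t; split; near: t.
    by have /cvgrPdist_lt := @continuous_cos R 0; exact.
  by have /cvgrPdist_lt := @continuous_sin R 0; exact.
move=> /nbhs_ballP[r r0 rP]; exists r => // t tr.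
have [] := rP t; first by rewrite /ball/= sub0r normrN.
move=> c s; apply: le_trans (normc_le_ReIm _) _; rewrite /= oppr0 addr0.
rewrite cos0 distrC in c; rewrite sin0 sub0r normrN in s.
by apply: ltW; rewrite [e]splitr ltrD.
Unshelve. all: by end_near. Qed.

Lemma char_unif d (k : 'I_d -> int) e : 0 < e ->
  exists2 r : R, 0 < r & forall u v : 'rV[R]_d,
    (forall i, `|u ord0 i - v ord0 i| < r) -> normc (char k u - char k v) <= e.
Proof.
move=> /cis_near1[r r0 rP].
pose C := 2 * pi * (1 + \sum_i `|(k i)%:~R|) : R.
have C0 : 0 < C.
  by rewrite !mulr_gt0 ?pi_gt0// ltr_pwDl// sumr_ge0.
exists (r / C); first by rewrite divr_gt0.
move=> u v uv.
have -> : char k u - char k v = char k v * (char k (u - v) - 1).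
  by rewrite charB mulrBr mulr1 mulrCA [_ * conjc _]mulrC char_conj mulr1.
rewrite ComplexField.Normc.normcM normc_char mul1r; apply: rP.
rewrite normrM (ger0_norm (_ : 0 <= 2 * pi)) ?mulr_ge0 ?pi_ge0//.
apply: (@le_lt_trans _ _ (2 * pi * (\sum_i `|(k i)%:~R| * (r / C)))).
  rewrite ler_pM2l ?mulr_gt0 ?pi_gt0//.
  apply: le_trans (ler_norm_sum _ _ _) _; apply: ler_sum => i _.
  by rewrite normrM !mxE ler_wpM2l// ltW.
rewrite -mulr_suml mulrA mulrCA -[ltRHS]mulr1 ltr_pM2l//.
by rewrite ltr_pdivrMr// mul1r ltr_pM2l ?mulr_gt0 ?pi_gt0// ltrDr.
Qed.

(** A nontrivial character is uniformly close to a step function on a fine grid,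
    and its values at the grid points sum to zero; so only the deviations of the
    cell frequencies from the cell volumes contribute to its average. *)
Lemma char_average_le d (k : 'I_d -> int) e : (exists i, k i != 0) -> 0 < e ->
  exists2 C : R, 0 <= C & forall (w : nat -> 'rV[R]_d) (N : nat),
    (forall n, (0 < n)%N -> unit_cube d (w n)) -> (0 < N)%N ->
    normc (N%:R^-1 * \sum_(1 <= n < N.+1) char k (w n)) <= e + C * discrepancy w N.
Proof.
move=> [i0 ki0] e0; have [r r0 rP] := char_unif k e0.
(* Large enough for the cells to be smaller than [r] and for the values of the
   character at the grid points to sum to zero. *)
pose M := (Num.truncn r^-1 + `|k i0|)%N.
have Mr : M.+1%:R^-1 < r.
  rewrite invf_plt ?posrE// ?ltr0n//; apply: lt_le_trans (truncnS_gt _) _.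
  by rewrite ler_nat ltnS leq_addr.
have kM : exists2 i, k i != 0 & (`|k i| < M.+1)%N by exists i0 => //; rewrite ltnS leq_addl.
exists ((M.+1 ^ d)%N%:R) => // w N wc N0.
have N0' : 0 < N%:R :> R by rewrite ltr0n.
pose g (j : {ffun 'I_d -> 'I_M.+1}) : R[i] := char k (grid_pt j).
pose cnt (j : {ffun 'I_d -> 'I_M.+1}) := (\sum_(1 <= n < N.+1 | w n \in cell j) 1)%N.
have step : \sum_(1 <= n < N.+1) g (cell_index M (w n)) = \sum_j (cnt j)%:R * g j.
  transitivity (\sum_(1 <= n < N.+1) \sum_(j | w n \in cell j) g j).
    apply: eq_big_nat => n /andP[n1 _].
    rewrite (big_pred1 (cell_index M (w n)))// => j.
    by rewrite mem_cell; [rewrite eq_sym|exact: wc].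
  rewrite (exchange_big_dep xpredT)//=; apply: eq_bigr => j _.
  by rewrite /cnt natr_sum mulr_suml; apply: eq_bigr => n _; rewrite mul1r.
have -> : N%:R^-1 * \sum_(1 <= n < N.+1) char k (w n) =
    N%:R^-1 * (\sum_(1 <= n < N.+1) (char k (w n) - g (cell_index M (w n)))) +
    \sum_j ((cnt j)%:R / N%:R - M.+1%:R^-1 ^+ d)%:C * g j.
  have -> : \sum_j ((cnt j)%:R / N%:R - M.+1%:R^-1 ^+ d)%:C * g j =
    N%:R^-1 * \sum_j (cnt j)%:R * g j.
    under eq_bigr => j _ do rewrite rmorphB/= mulrBl.
    rewrite sumrB -[X in _ - X]mulr_sumr sum_char_grid// mulr0 subr0 mulr_sumr.
    by apply: eq_bigr => j _; rewrite rmorphM/= fmorphV/= !rmorph_nat mulrA [_^-1 * _]mulrC.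
  by rewrite -step -mulrDr -big_split/=; congr (_ * _); apply: eq_bigr => n _; rewrite subrK.
apply: le_trans (le_normcD _ _) _; apply: lerD.
  rewrite ComplexField.Normc.normcM ComplexField.Normc.normcV.
  rewrite normc_nat.
  rewrite ler_pdivrMl//; apply: le_trans (normc_sum _ _ _) _.
  apply: (@le_trans _ _ (\sum_(1 <= n < N.+1) e)).
    apply: ler_sum_nat => n /andP[n1 _]; apply: rP => i.
    by apply: le_lt_trans Mr; apply: cell_near; apply: cell_index_cell; exact: wc.
  by rewrite sumr_const_nat subn1/= mulr_natl.
apply: le_trans (normc_sum _ _ _) _.
rewrite -card_cells mulr_natl -sumr_const; apply: ler_sum => j _.
rewrite ComplexField.Normc.normcM normc_char mulr1 normc_real.
have := box_dev_le w N (cell_is_box j) (@sub_cell_cube _ _ _ j).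
by rewrite lebesgue_cell.
Qed.

End char_average.

(** * Continuous functions on the cube *)

Section continuous_on_cube.
Context {R : realType} {d : nat}.
Implicit Types (f : 'rV[R]_d -> R[i]).

Lemma compact_unit_cube : compact (unit_cube d : set 'rV[R]_d).
Proof.
rewrite (_ : unit_cube d = [set v : 'rV[R]_d | forall i, `[0, 1]%classic (v ord0 i)]).
  exact: (@rV_compact R d (fun=> `[0, 1]%classic) (fun=> @segment_compact R 0 1)).
by apply/seteqP; split => v vc i; have := vc i; rewrite /= in_itv.
Qed.

Lemma unif_continuous_cube f : {within unit_cube d, continuous f} ->
  forall e : R, 0 < e -> exists2 r : R, 0 < r &
    forall u v, unit_cube d u -> unit_cube d v ->
      (forall i, `|u ord0 i - v ord0 i| < r) -> normc (f u - f v) < e.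
Proof.
move=> cf e e0.
have := compact_unit_cube => /compact_near_coveringP/near_covering_withinP.
move=> /(_ R (0 : R)^'+ (fun r u => forall v, unit_cube d v ->
   (forall i, `|u ord0 i - v ord0 i| < r) -> normc (f u - f v) < e)) H.
have [r [r0 rP]] : exists r : R, 0 < r /\ (unit_cube d `<=` fun u => forall v, unit_cube d v ->
   (forall i, `|u ord0 i - v ord0 i| < r) -> normc (f u - f v) < e).
  apply: (@filter_ex _ (0:R)^'+); apply: filterI; first exact: nbhs_right_gt.
  apply: H => u uc.
  have e20 : 0 < e / 2 by rewrite divr_gt0.
  have : \forall v \near within (unit_cube d) (nbhs u), normc (f u - f v) < e / 2.
    have : f @ within (unit_cube d) (nbhs u) --> f u.
      by rewrite (nbhs_subspace_in uc); exact: cf.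
    move=> /cvgrPdist_lt /(_ (e / 2)%:C); rewrite ltcR => /(_ e20).
    by apply: filterS => v; rewrite -normcE ltcR.
  move=> /nbhs_ballP[s s0 sP].
  have s20 : 0 < s / 2 by rewrite divr_gt0.
  near=> u' r => /= u'c v vc u'v.
  have u'u i : `|u ord0 i - u' ord0 i| < s / 2.
    have : ball u (s / 2) u' by near: u'; exact: nbhsx_ballx.
    by move=> [_ /(_ ord0 i)].
  have -> : f u' - f v = (f u - f v) - (f u - f u') by ring.
  apply: le_lt_trans (normcB_le _ _) _; rewrite [e]splitr; apply: ltrD; apply: sP => //.
    split=> // i j; rewrite (ord1 i) /ball /= -(subrK (u' ord0 j) (u ord0 j)) -addrA.
    apply: le_lt_trans (ler_normD _ _) _; rewrite [s]splitr; apply: ltrD => //.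
    by apply: lt_le_trans (u'v j) _; near: r; exact: nbhs_right_le.
  split=> // i j; rewrite (ord1 i) /ball/=; apply: lt_trans (u'u j) _.
  by rewrite ltr_pdivrMr// ltr_pMr// ltr1n.
by exists r => // u v uc; exact: rP.
Unshelve. all: by end_near. Qed.

End continuous_on_cube.

Lemma Rintegral_dev_le d (T : measurableType d) (R : realType)
    (mu : {measure set T -> \bar R}) (A : set T) (g : T -> R) (c e : R) :
  measurable A -> (mu A < +oo)%E -> mu.-integrable A (EFin \o g) ->
  (forall x, A x -> `|g x - c| <= e) ->
  `|\int[mu]_(x in A) g x - c * fine (mu A)| <= e * fine (mu A).
Proof.
move=> mA fA ig ge; have ic (a : R) : mu.-integrable A (EFin \o cst a).
  by apply: measurable_bounded_integrable => //; exact: bounded_cst.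
rewrite -Rintegral_cst// -RintegralB//; last exact: ic.
have ib : mu.-integrable A (EFin \o (fun x => g x - c)).
  by apply: (@integrableB _ _ _ mu A mA (EFin \o g) (EFin \o cst c)) => //; exact: ic.
apply: le_trans (le_normr_Rintegral mA ib) _.
rewrite -Rintegral_cst//; apply: le_Rintegral => //; last exact: ic.
exact: (integrable_norm ib).
Qed.

Section riemann_sums.
Context {R : realType} {d : nat}.
Implicit Types (f : 'rV[R]_d -> R[i]) (g : 'rV[R]_d -> R).

(** This consequence of uniform continuity is all that the integral of [g] needs,
    measurability included. *)
Definition grid_continuous g := forall e : R, 0 < e ->
  \forall M \near \oo, forall (j : {ffun 'I_d -> 'I_M.+1}) u,
    cell j u -> `|g u - g (grid_pt j)| <= e.

Lemma continuous_grid f : {within unit_cube d, continuous f} ->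
  forall e : R, 0 < e ->
  \forall M \near \oo, forall (j : {ffun 'I_d -> 'I_M.+1}) u,
    cell j u -> normc (f u - f (grid_pt j)) <= e.
Proof.
move=> cf e e0; have [r r0 rP] := unif_continuous_cube cf e0.
near=> M => j u uj; apply/ltW/rP; [exact: sub_cell_cube uj|exact: grid_pt_cube|] => i.
apply: le_lt_trans (cell_near uj i) _.
rewrite invf_plt ?posrE ?ltr0n//; apply: lt_le_trans (truncnS_gt _) _.
by rewrite ler_nat ltnS; near: M; exact: nbhs_infty_ge.
Unshelve. all: by end_near. Qed.

Lemma grid_continuous_Re f : {within unit_cube d, continuous f} ->
  grid_continuous (fun u => complex.Re (f u)).
Proof.
move=> cf e /(continuous_grid cf); apply: filterS => M H j u /H.
by apply: le_trans; rewrite -raddfB; exact: normc_Re_le.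
Qed.

Lemma grid_continuous_Im f : {within unit_cube d, continuous f} ->
  grid_continuous (fun u => complex.Im (f u)).
Proof.
move=> cf e /(continuous_grid cf); apply: filterS => M H j u /H.
by apply: le_trans; rewrite -raddfB; exact: normc_Im_le.
Qed.

Lemma bounded_grid_continuous g : grid_continuous g ->
  exists C : R, forall u, unit_cube d u -> `|g u| <= C.
Proof.
move=> gc; have /filter_ex[M MP] := gc 1 ltr01.
exists (1 + \sum_(j : {ffun 'I_d -> 'I_M.+1}) `|g (grid_pt j)|).
move=> u uc; rewrite -(subrK (g (grid_pt (cell_index M u))) (g u)).
apply: le_trans (ler_normD _ _) _; apply: lerD.
  by apply: MP; exact: cell_index_cell.
by rewrite (bigD1 (cell_index M u))//= lerDl sumr_ge0.
Qed.

Lemma bounded_on_cube f : {within unit_cube d, continuous f} ->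
  exists2 C : R, 0 < C & forall u, unit_cube d u -> normc (f u) <= C.
Proof.
move=> cf; have [C CP] := bounded_grid_continuous (grid_continuous_Re cf).
have [D DP] := bounded_grid_continuous (grid_continuous_Im cf).
exists (1 + `|C| + `|D|); first by rewrite !ltr_wpDr.
move=> u uc; apply: le_trans (normc_le_ReIm _) _.
have := CP u uc; have := DP u uc; have := ler_norm C; have := ler_norm D; lra.
Qed.

(** The sigma-algebra is generated by the coordinates, for which only the boxes are
    measurable at once; so [g] is exhibited as a pointwise limit of step functions. *)
Lemma measurable_grid_continuous g : grid_continuous g ->
  measurable_fun (unit_cube d) g.
Proof.
move=> gc.
pose h (M : nat) (u : 'rV[R]_d) : R :=
  \sum_(j : {ffun 'I_d -> 'I_M.+1}) g (grid_pt j) * \1_(cell j) u.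
apply: (@measurable_fun_cvg _ _ _ _ h) => [M|u uc].
  apply: measurable_sum => j; apply: measurable_funM => //.
  by apply: measurable_indic; exact: measurable_cell.
have hE M : h M u = g (grid_pt (cell_index M u)).
  rewrite /h (bigD1 (cell_index M u))//= indicE mem_cell// eqxx mulr1.
  rewrite big1 ?addr0// => j jE; rewrite indicE mem_cell//.
  by rewrite eq_sym (negbTE jE) mulr0.
apply/cvgrPdist_le => e e0; have := gc e e0; apply: filterS => M MP.
by rewrite hE; apply: MP; exact: cell_index_cell.
Qed.

Lemma integrable_grid_continuous g : grid_continuous g ->
  (lebesgue_rV d).-integrable (unit_cube d) (EFin \o g).
Proof.
move=> gc; apply: measurable_bounded_integrable.
- exact: measurable_unit_cube.
- by rewrite [X in (X < _)%E](lebesgue_unit_cube d) ltry.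
- exact: measurable_grid_continuous.
have [C CP] := bounded_grid_continuous gc.
exists C; split; first exact: num_real.
by move=> M CM u uc; apply: le_trans (CP u uc) (ltW CM).
Qed.

Lemma unit_cube_cells M :
  unit_cube d = \big[setU/set0]_(j : {ffun 'I_d -> 'I_M.+1}) (cell j : set 'rV[R]_d).
Proof.
rewrite -bigcup_seq; apply/seteqP; split => [u uc|u [j _]]; last exact: sub_cell_cube.
by exists (cell_index M u); [rewrite /= mem_index_enum|exact: cell_index_cell].
Qed.

Lemma riemann_sum_cvg g : grid_continuous g -> forall e : R, 0 < e ->
  \forall M \near \oo, `| \int[lebesgue_rV d]_(x in unit_cube d) g x -
    M.+1%:R^-1 ^+ d * \sum_(j : {ffun 'I_d -> 'I_M.+1}) g (grid_pt j) | <= e.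
Proof.
move=> gc e e0; have := gc e e0; apply: filterS => M MP.
have ig (j : {ffun 'I_d -> 'I_M.+1}) : (lebesgue_rV d).-integrable (cell j) (EFin \o g).
  apply: integrableS (integrable_grid_continuous gc).
  - exact: measurable_unit_cube.
  - exact: measurable_cell.
  - exact: sub_cell_cube.
have -> : \int[lebesgue_rV d]_(x in unit_cube d) g x =
    \sum_(j : {ffun 'I_d -> 'I_M.+1}) \int[lebesgue_rV d]_(x in cell j) g x.
  rewrite /Rintegral (unit_cube_cells M) integral_bigsetU_EFin.
  - by rewrite sum_fine// => j _; apply: integrable_fin_num; first exact: measurable_cell.
  - by move=> j; exact: measurable_cell.
  - exact: index_enum_uniq.
  - move=> i j _ _ [u [ui uj]]; have uc := sub_cell_cube ui.
    by move/mem_set : ui; move/mem_set : uj; rewrite !mem_cell// => /eqP <- /eqP.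
  - by rewrite -unit_cube_cells; apply/measurable_EFinP; exact: measurable_grid_continuous.
rewrite mulr_sumr -sumrB; apply: le_trans (ler_norm_sum _ _ _) _.
apply: (@le_trans _ _ (\sum_(j : {ffun 'I_d -> 'I_M.+1}) e * M.+1%:R^-1 ^+ d)).
  apply: ler_sum => j _.
  have mE : fine (lebesgue_rV d (cell j)) = M.+1%:R^-1 ^+ d :> R by rewrite lebesgue_cell.
  rewrite -mE mulrC; apply: Rintegral_dev_le => //; first exact: measurable_cell.
    by rewrite [X in (X < _)%E](lebesgue_cell j) ltry.
  by move=> x xj; exact: MP.
rewrite sumr_const card_cells -[leLHS]mulr_natr natrX -mulrA -exprMn mulVf ?pnatr_eq0//.
by rewrite expr1n mulr1.
Qed.

End riemann_sums.

(** * Averaged correlations *)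

Section averaged_correlations.
Context {R : realType}.
Implicit Types (z y : nat -> R[i]) (e : R).

Definition averaged_correlation z y M H : R :=
  H%:R^-1 * \sum_(1 <= h < H.+1) normc (correlation z y M h).

(** Unlike near weak mixing, this property involves no subsequence along which
    limits exist, so it passes to linear combinations and to approximations. *)
Definition decorrelated z := forall y, (forall n, normc (y n) <= 1) ->
  forall e, 0 < e ->
  \forall H \near \oo, \forall M \near \oo, averaged_correlation z y M H <= e.

Lemma averaged_correlation_ge0 z y M H : 0 <= averaged_correlation z y M H.
Proof. by rewrite mulr_ge0 ?invr_ge0// sumr_ge0// => h _; exact: normc_ge0. Qed.

Lemma averaged_correlationD z1 z2 y M H :
  averaged_correlation (z1 \+ z2) y M H <=
  averaged_correlation z1 y M H + averaged_correlation z2 y M H.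
Proof.
rewrite -mulrDr ler_wpM2l ?invr_ge0// -big_split/=; apply: ler_sum => h _.
rewrite (_ : correlation _ _ _ _ = correlation z1 y M h + correlation z2 y M h).
  exact: le_normcD.
rewrite /correlation -mulrDr -big_split/=; congr (_ * _).
by apply: eq_bigr => n _; rewrite mulrDl.
Qed.

Lemma averaged_correlationZ (c : R[i]) z y M H :
  averaged_correlation (fun n => c * z n) y M H = normc c * averaged_correlation z y M H.
Proof.
rewrite /averaged_correlation [RHS]mulrCA [in RHS]mulr_sumr; congr (_ * _); apply: eq_bigr => h _.
rewrite -ComplexField.Normc.normcM; congr normc.
rewrite /correlation [RHS]mulrCA [in RHS]mulr_sumr; congr (_ * _).
by apply: eq_bigr => n _; rewrite mulrA.
Qed.

Lemma decorrelatedD z1 z2 : decorrelated z1 -> decorrelated z2 ->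
  decorrelated (z1 \+ z2).
Proof.
move=> g1 g2 y y1 e e0; have e20 : 0 < e / 2 by rewrite divr_gt0.
apply: filterS2 (g1 y y1 _ e20) (g2 y y1 _ e20) => H; apply: filterS2 => M h1 h2.
apply: le_trans (averaged_correlationD _ _ _ _ _) _.
by rewrite [e]splitr lerD.
Qed.

Lemma decorrelatedZ (c : R[i]) z : decorrelated z -> decorrelated (fun n => c * z n).
Proof.
move=> g y y1 e e0; have c0 := normc_ge0 c.
have c1 : 0 < normc c + 1 by rewrite ltr_wpDl.
have := g y y1 (e / (normc c + 1)) (divr_gt0 e0 c1).
apply: filterS => H; apply: filterS => M; rewrite ler_pdivlMr// averaged_correlationZ => h.
apply: le_trans h; rewrite mulrC ler_wpM2l ?averaged_correlation_ge0//.
by rewrite lerDl.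
Qed.

Lemma decorrelated0 : decorrelated (fun=> 0).
Proof.
move=> y _ e e0; near=> H; near=> M; rewrite /averaged_correlation big1 ?mulr0 ?ltW// => h _.
rewrite /correlation big1 ?mulr0 ?ComplexField.Normc.normc0// => n _.
by rewrite mul0r.
Unshelve. all: by end_near. Qed.

Lemma decorrelated_sum (I : Type) (r : seq I) (P : pred I) (F : I -> nat -> R[i]) :
  (forall i, P i -> decorrelated (F i)) ->
  decorrelated (fun n => \sum_(i <- r | P i) F i n).
Proof.
move=> g; elim: r => [|i r ih].
  by under eq_fun do rewrite big_nil; exact: decorrelated0.
under eq_fun do rewrite big_cons.
by case Pi: (P i) => //; apply: decorrelatedD => //; exact: g.
Qed.

Lemma correlation_le_mean z y M h H : (forall n, normc (y n) <= 1) -> (h <= H)%N ->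
  normc (correlation z y M h) <= M%:R^-1 * \sum_(1 <= n < (M + H).+1) normc (z n).
Proof.
move=> y1 hH; rewrite /correlation ComplexField.Normc.normcM ComplexField.Normc.normcV.
rewrite normc_nat ler_wpM2l ?invr_ge0//; apply: le_trans (normc_sum _ _ _) _.
apply: (@le_trans _ _ (\sum_(1 <= n < M.+1) normc (z (n + h)%N))).
  apply: ler_sum => n _; rewrite ComplexField.Normc.normcM normc_conj.
  by rewrite -[leRHS]mulr1 ler_wpM2l ?normc_ge0.
have -> : \sum_(1 <= n < M.+1) normc (z (n + h)%N) =
    \sum_(1 + h <= n < M.+1 + h) normc (z n) by rewrite big_addn addnK.
rewrite [leRHS](big_cat_nat (n := 1 + h))//=; last by rewrite add1n ltnS (leq_trans hH) ?leq_addl.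
rewrite [X in _ <= _ + X](big_cat_nat (n := M.+1 + h))/=.
- rewrite addrA -[leLHS]add0r -[leLHS]addr0 lerD// ?lerD// sumr_ge0// => n _; exact: normc_ge0.
- by rewrite leq_add2r.
- by rewrite addSn ltnS leq_add2l.
Qed.

(** For a fixed range of shifts, the shifted means are at most twice the mean over
    a slightly longer range; this is why closeness in mean is enough. *)
Lemma decorrelated_approx z :
  (forall e, 0 < e -> exists2 w, decorrelated w &
     \forall M \near \oo, M%:R^-1 * (\sum_(1 <= n < M.+1) normc (z n - w n)) <= e) ->
  decorrelated z.
Proof.
move=> app y y1 e e0; have e40 : 0 < e / 4 by rewrite divr_gt0.
have e20 : 0 < e / 2 by rewrite divr_gt0.
have [w gw zw] := app _ e40; near=> H.
have H0 : (0 < H)%N by near: H; exact: nbhs_infty_gt.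
have gH : \forall M \near \oo, averaged_correlation w y M H <= e / 2.
  by near: H; exact: gw.
near=> M; have M0 : 0 < M%:R :> R by rewrite ltr0n; near: M; exact: nbhs_infty_gt.
have -> : z = (w \+ (z \- w)) by apply/funext => n /=; rewrite addrC subrK.
apply: le_trans (averaged_correlationD _ _ _ _ _) _; rewrite [e]splitr; apply: lerD.
  by near: M.
rewrite ler_pdivrMl ?ltr0n//.
apply: (@le_trans _ _ (\sum_(1 <= h < H.+1) e / 2)); last first.
  by rewrite sumr_const_nat subn1 mulr_natl.
apply: ler_sum_nat => h /andP[_ hH].
apply: le_trans (correlation_le_mean _ _ y1 (_ : (h <= H)%N)) _ => //.
rewrite ler_pdivrMl//.
have : (M + H)%:R^-1 * (\sum_(1 <= n < (M + H).+1) normc (z n - w n)) <= e / 4.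
  near: M; have [K _ KP] := zw; exists K => // n /= Kn; apply: KP => /=.
  by rewrite (leq_trans Kn)// leq_addr.
rewrite ler_pdivrMl ?ltr0n ?addn_gt0 ?H0 ?orbT// => h1; apply: le_trans h1 _.
have HM : H%:R <= M%:R :> R by rewrite ler_nat; near: M; exact: nbhs_infty_ge.
rewrite natrD; nra.
Unshelve. all: by end_near. Qed.

End averaged_correlations.

(** * The van der Corput inequality *)

Section van_der_Corput.
Context {R : realType}.
Implicit Types (z y : nat -> R[i]) (e : R).

Lemma sqr_mean_le (a : nat -> R) M :
  (M%:R^-1 * \sum_(1 <= n < M.+1) a n) ^+ 2 <= M%:R^-1 * \sum_(1 <= n < M.+1) a n ^+ 2.
Proof.
case: M => [|M]; first by rewrite invr0 !mul0r expr0n.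
have M0 : M.+1%:R != 0 :> R by rewrite pnatr_eq0.
set m := _ * _; rewrite -subr_ge0.
have mE : \sum_(1 <= n < M.+2) a n = M.+1%:R * m by rewrite mulrA divff// mul1r.
have -> : M.+1%:R^-1 * \sum_(1 <= n < M.+2) a n ^+ 2 - m ^+ 2 =
    M.+1%:R^-1 * \sum_(1 <= n < M.+2) (a n - m) ^+ 2.
  under [in RHS]eq_bigr do rewrite sqrrB.
  rewrite big_split sumrB/= sumrMnl -mulr_suml mE sumr_const_nat subn1/= -mulr_natl.
  by field.
by rewrite mulr_ge0// sumr_ge0// => n _; exact: sqr_ge0.
Qed.

Definition phase (c : R[i]) : R[i] := (normc c)%:C^-1 * conjc c.

Lemma normc_phase c : normc (phase c) <= 1.
Proof.
rewrite /phase ComplexField.Normc.normcM ComplexField.Normc.normcV normc_real normc_conj.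
rewrite ger0_norm ?normc_ge0//; have [->|c0] := eqVneq (normc c) 0.
  by rewrite mulr0.
by rewrite mulVf.
Qed.

Lemma phaseM c : phase c * c = (normc c)%:C.
Proof.
rewrite /phase -mulrA [conjc c * c]mulrC -normc_sqr.
have [->|c0] := eqVneq (normc c) 0; first by rewrite expr0n/= mulr0.
by rewrite rmorphXn/= expr2 mulrA mulVf ?mul1r// fmorph_eq0.
Qed.

(** Rotating each correlation onto the positive axis turns their sum into one
    inner product with [y]; the Cauchy-Schwarz inequality then removes [y] and
    leaves the mutual correlations of the shifts of [z]. *)
Lemma bessel z y M H : (forall n, normc (y n) <= 1) ->
  averaged_correlation z y M H ^+ 2 <= H%:R^-1 ^+ 2 *
  \sum_(1 <= h < H.+1) \sum_(1 <= k < H.+1)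
    normc (M%:R^-1 * \sum_(1 <= n < M.+1) z (n + h)%N * conjc (z (n + k)%N)).
Proof.
move=> y1; rewrite exprMn ler_wpM2l ?sqr_ge0//.
pose eps h := phase (correlation z y M h).
pose V n := \sum_(1 <= h < H.+1) eps h * z (n + h)%N.
have sumE : (\sum_(1 <= h < H.+1) normc (correlation z y M h))%:C =
    M%:R^-1 * \sum_(1 <= n < M.+1) V n * conjc (y n).
  rewrite rmorph_sum/= (eq_bigr (fun h => eps h * correlation z y M h)); last first.
    by move=> h _; rewrite phaseM.
  rewrite [in RHS](eq_bigr (fun n => \sum_(1 <= h < H.+1)
      eps h * (z (n + h)%N * conjc (y n)))); last first.
    by move=> n _; rewrite mulr_suml; apply: eq_bigr => h _; rewrite mulrA.
  rewrite exchange_big mulr_sumr; apply: eq_bigr => h _.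
  by rewrite /correlation mulrCA mulr_sumr.
have s0 : 0 <= \sum_(1 <= h < H.+1) normc (correlation z y M h).
  by rewrite sumr_ge0// => h _; exact: normc_ge0.
apply: (@le_trans _ _ ((M%:R^-1 * \sum_(1 <= n < M.+1) normc (V n)) ^+ 2)).
  rewrite ler_sqr ?nnegrE//; last first.
    by rewrite mulr_ge0 ?invr_ge0// sumr_ge0// => n _; exact: normc_ge0.
  rewrite -[leLHS]ger0_norm// -normc_real sumE ComplexField.Normc.normcM.
  rewrite ComplexField.Normc.normcV normc_nat ler_wpM2l ?invr_ge0//.
  apply: le_trans (normc_sum _ _ _) _; apply: ler_sum => n _.
  by rewrite ComplexField.Normc.normcM normc_conj -[leRHS]mulr1 ler_wpM2l ?normc_ge0.
apply: le_trans (sqr_mean_le _ _) _.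
have VE : (M%:R^-1 * \sum_(1 <= n < M.+1) normc (V n) ^+ 2)%:C =
    \sum_(1 <= h < H.+1) \sum_(1 <= k < H.+1) eps h * conjc (eps k) *
    (M%:R^-1 * \sum_(1 <= n < M.+1) z (n + h)%N * conjc (z (n + k)%N)).
  rewrite rmorphM/= fmorphV/= rmorph_nat rmorph_sum/=.
  transitivity (M%:R^-1 * \sum_(1 <= n < M.+1) \sum_(1 <= h < H.+1)
     \sum_(1 <= k < H.+1) eps h * conjc (eps k) * (z (n + h)%N * conjc (z (n + k)%N))).
    congr (_ * _); apply: eq_bigr => n _; rewrite normc_sqr /V conjc_sum big_distrlr/=.
    by apply: eq_bigr => h _; apply: eq_bigr => k _; rewrite rmorphM/= mulrACA.
  rewrite exchange_big mulr_sumr; apply: eq_bigr => h _.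
  rewrite exchange_big mulr_sumr; apply: eq_bigr => k _.
  by rewrite -mulr_sumr mulrCA.
rewrite -[leLHS]ger0_norm; last first.
  by rewrite mulr_ge0 ?invr_ge0// sumr_ge0// => n _; exact: sqr_ge0.
rewrite -normc_real VE; apply: le_trans (normc_sum _ _ _) _; apply: ler_sum => h _.
apply: le_trans (normc_sum _ _ _) _; apply: ler_sum => k _.
rewrite 2!ComplexField.Normc.normcM normc_conj -[leRHS]mul1r ler_wpM2r ?normc_ge0//.
by rewrite mulr_ile1 ?normc_ge0 ?normc_phase.
Qed.

(** Moving a window by one step exchanges one term for another. *)
Lemma normc_shift_sum (F : nat -> R[i]) M k : (forall n, normc (F n) <= 1) ->
  normc (\sum_(1 <= n < M.+1) F (n + k)%N - \sum_(1 <= n < M.+1) F n) <= 2 * k%:R.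
Proof.
move=> F1; elim: k => [|k ih].
  under eq_bigr do rewrite addn0.
  by rewrite subrr ComplexField.Normc.normc0 mulr0.
have -> : \sum_(1 <= n < M.+1) F (n + k.+1)%N =
    \sum_(1 <= n < M.+1) F (n + k)%N + (F (M.+1 + k)%N - F (1 + k)%N).
  have := telescope_sumr (fun n => F (n + k)%N) (leq0n M : (1 <= M.+1)%N).
  rewrite sumrB => <-; rewrite addrC subrK.
  by apply: eq_bigr => n _; rewrite addnS.
rewrite addrAC -[k.+1%:R]natr1 mulrDr mulr1; apply: le_trans (le_normcD _ _) _; apply: lerD => //.
by apply: le_trans (normcB_le _ _) _; rewrite -[leRHS]natr1 lerD.
Qed.

(** Every distance from [h] occurs at most twice, once on each side. *)
Lemma sum_dist_le (G : nat -> R) h H : (forall l, 0 <= G l) -> (1 <= h < H.+1)%N ->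
  \sum_(1 <= k < H.+1) G ((h - k) + (k - h))%N <= G 0%N + 2 * \sum_(1 <= l < H.+1) G l.
Proof.
move=> G0 /andP[h1 hH]; rewrite (big_cat_nat (n := h))//=; last exact: ltnW.
rewrite [X in _ + X]big_ltn// subnn addn0 addrCA lerD2l mulr_natl mulr2n; apply: lerD.
  rewrite big_nat_rev/= [leRHS](big_cat_nat (n := h))//=; last exact: ltnW.
  rewrite -[leLHS]addr0 lerD ?sumr_ge0//; apply: ler_sum_nat => k /andP[k1 kh].
  by rewrite add1n subSS subKn ?(ltnW kh)// (eqP (leq_subr _ _ : _)) addn0.
rewrite -add1n big_addn [leRHS](big_cat_nat (n := (H.+1 - h)%N))//=; last first.
- by rewrite leq_subr.
- by rewrite subn_gt0.
rewrite -[leLHS]addr0 lerD ?sumr_ge0//; apply: ler_sum_nat => k /andP[k1 kh].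
by rewrite addnK (eqP (leq_addl _ _ : _)) add0n.
Qed.

(** Up to a boundary error, the correlation of two shifts depends only on the
    distance between the shifts. *)
Lemma shifted_correlation_le z M H h k : (forall n, normc (z n) <= 1) ->
  (h <= H)%N -> (k <= H)%N ->
  normc (M%:R^-1 * \sum_(1 <= n < M.+1) z (n + h)%N * conjc (z (n + k)%N)) <=
  normc (correlation z z M ((h - k) + (k - h))%N) + 2 * H%:R / M%:R.
Proof.
move=> z1; wlog kh : h k / (k <= h)%N => [wh hH kH|].
  have [|/ltnW hk] := leqP k h; first by move=> kh; exact: wh.
  rewrite addnC; have := wh k h hk kH hH; congr (_ <= _).
  rewrite -normc_conj; congr normc; rewrite rmorphM/= fmorphV/= rmorph_nat; congr (_ * _).
  by rewrite conjc_sum; apply: eq_bigr => n _; rewrite rmorphM/= conjcK mulrC.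
move=> hH kH; rewrite (eqP (kh : (k - h == 0)%N)) addn0.
pose F n := z (n + (h - k))%N * conjc (z n).
have F1 n : normc (F n) <= 1.
  by rewrite /F ComplexField.Normc.normcM normc_conj mulr_ile1 ?normc_ge0.
rewrite (eq_bigr (fun n => F (n + k)%N)); last by move=> n _; rewrite /F -addnA subnKC.
have -> : M%:R^-1 * \sum_(1 <= n < M.+1) F (n + k)%N = correlation z z M (h - k) +
    M%:R^-1 * (\sum_(1 <= n < M.+1) F (n + k)%N - \sum_(1 <= n < M.+1) F n).
  by rewrite /correlation -mulrDr addrC subrK.
apply: le_trans (le_normcD _ _) _; rewrite lerD2l ComplexField.Normc.normcM.
rewrite ComplexField.Normc.normcV normc_nat mulrC ler_wpM2r ?invr_ge0//.
apply: le_trans (normc_shift_sum _ _ F1) _.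
by rewrite ler_pM2l// ler_nat.
Qed.

(** In the double sum of [bessel] the diagonal contributes [1 / H], and any other
    distance between shifts recurs at most [2 H] times. *)
Lemma van_der_Corput z y M H : (forall n, normc (z n) <= 1) ->
  (forall n, normc (y n) <= 1) ->
  averaged_correlation z y M H.+1 ^+ 2 <=
  H.+1%:R^-1 + 2 * averaged_correlation z z M H.+1 + 2 * H.+1%:R / M%:R.
Proof.
move=> z1 y1; apply: le_trans (bessel _ _ _ y1) _.
have H0 : 0 < H.+1%:R :> R by rewrite ltr0n.
pose G l := normc (correlation z z M l).
have G1 : G 0%N <= 1.
  rewrite /G /correlation ComplexField.Normc.normcM ComplexField.Normc.normcV normc_nat.
  have [->|M0] := posnP M; first by rewrite invr0 mul0r.
  rewrite ler_pdivrMl ?ltr0n// mulr1; apply: le_trans (normc_sum _ _ _) _.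
  apply: (@le_trans _ _ (\sum_(1 <= n < M.+1) 1)).
    by apply: ler_sum => n _; rewrite ComplexField.Normc.normcM normc_conj mulr_ile1 ?normc_ge0.
  by rewrite sumr_const_nat subn1.
apply: (@le_trans _ _ (H.+1%:R^-1 ^+ 2 * \sum_(1 <= h < H.+2)
   (1 + 2 * (\sum_(1 <= l < H.+2) G l) + H.+1%:R * (2 * H.+1%:R / M%:R)))).
  rewrite ler_wpM2l ?sqr_ge0//; apply: ler_sum_nat => h hH.
  apply: (@le_trans _ _ (\sum_(1 <= k < H.+2)
     (G ((h - k) + (k - h))%N + 2 * H.+1%:R / M%:R))).
    apply: ler_sum_nat => k /andP[_ kH]; apply: shifted_correlation_le => //.
    by have /andP[] := hH.
  rewrite big_split/= sumr_const_nat subn1/= -[_ *+ H.+1]mulr_natl lerD2r.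
  apply: le_trans (sum_dist_le _ hH) _; first by move=> l; exact: normc_ge0.
  by rewrite lerD2r.
rewrite sumr_const_nat subn1/= -[X in _ * X]mulr_natl /averaged_correlation.
rewrite -/(G _) le_eqVlt; apply/orP; left; apply/eqP.
have H0' : H.+1%:R != 0 :> R by rewrite gt_eqF.
move: (\sum_(1 <= l < _) _) (M%:R^-1) => S m.
by field.
Qed.

(** Van der Corput's difference theorem: correlations of [z] with itself control
    those with every other sequence. *)
Lemma decorrelated_of_self z : (forall n, normc (z n) <= 1) ->
  (forall e, 0 < e ->
    \forall H \near \oo, \forall M \near \oo, averaged_correlation z z M H <= e) ->
  decorrelated z.
Proof.
move=> z1 self y y1 e e0; have e80 : 0 < e ^+ 2 / 8 by rewrite divr_gt0// exprn_gt0.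
have e40 : 0 < e ^+ 2 / 4 by rewrite divr_gt0// exprn_gt0.
near=> H.
have [H' HE] : exists H', H = H'.+1.
  by exists H.-1; rewrite prednK//; near: H; exact: nbhs_infty_gt.
have HM : H%:R^-1 <= e ^+ 2 / 4.
  rewrite HE invf_ple ?posrE ?ltr0n//; apply/ltW/(lt_le_trans (truncnS_gt _)).
  by rewrite ler_nat -HE; near: H; exact: nbhs_infty_ge.
have selfH : \forall M \near \oo, averaged_correlation z z M H <= e ^+ 2 / 8.
  by near: H; exact: self.
near=> M.
have M0 : 0 < M%:R :> R by rewrite ltr0n; near: M; exact: nbhs_infty_gt.
have MH : 2 * H%:R / M%:R <= e ^+ 2 / 4.
  rewrite ler_pdivrMr// -ler_pdivrMl//; apply/ltW/(lt_le_trans (truncnS_gt _)).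
  by rewrite ler_nat; near: M; exact: nbhs_infty_ge.
have sH : averaged_correlation z z M H <= e ^+ 2 / 8 by near: M.
have := van_der_Corput M H' z1 y1; rewrite -HE => vdc.
rewrite -ler_sqr ?nnegrE; [|exact: averaged_correlation_ge0|exact: ltW].
apply: le_trans vdc _; lra.
Unshelve. all: by end_near. Qed.

(** Correlation with the constant sequence [1] is the mean, whatever the shift. *)
Lemma decorrelated_mean z : (forall n, normc (z n) <= 1) -> decorrelated z ->
  forall e, 0 < e ->
  \forall M \near \oo, normc (M%:R^-1 * \sum_(1 <= n < M.+1) z n) <= e.
Proof.
move=> z1 dz e e0; have e20 : 0 < e / 2 by rewrite divr_gt0.
have one1 (n : nat) : normc (1 : R[i]) <= 1 by rewrite ComplexField.Normc.normc1.
have [[|H] [H0 HP]] : exists H, (0 < H)%N /\ \forall M \near \oo,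
   averaged_correlation z (fun=> 1) M H <= e / 2.
- apply: (@filter_ex _ \oo); apply: filterI; first exact: nbhs_infty_gt.
  exact: dz.
- by [].
near=> M; have M0 : 0 < M%:R :> R by rewrite ltr0n; near: M; exact: nbhs_infty_gt.
have MH : 2 * H.+1%:R / M%:R <= e / 2.
  rewrite ler_pdivrMr// -ler_pdivrMl//; apply/ltW/(lt_le_trans (truncnS_gt _)).
  by rewrite ler_nat; near: M; exact: nbhs_infty_ge.
have : averaged_correlation z (fun=> 1) M H.+1 <= e / 2 by near: M.
set m := normc _; rewrite /averaged_correlation ler_pdivrMl ?ltr0n// => aH.
have hm h : (1 <= h < H.+2)%N -> m <= normc (correlation z (fun=> 1) M h) + e / 2.
  move=> /andP[_ hH]; rewrite /correlation.
  under [in leRHS]eq_bigr do rewrite conjc1 mulr1.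
  rewrite /m -[\sum_(1 <= n < M.+1) z n](subKr (\sum_(1 <= n < M.+1) z (n + h)%N)).
  rewrite mulrBr; apply: le_trans (normcB_le _ _) _; rewrite lerD2l.
  rewrite ComplexField.Normc.normcM ComplexField.Normc.normcV normc_nat.
  apply: le_trans MH; rewrite mulrC ler_wpM2r ?invr_ge0//.
  apply: le_trans (normc_shift_sum _ _ z1) _.
  by rewrite ler_pM2l// ler_nat.
have H0' : 0 < H.+1%:R :> R by rewrite ltr0n.
have : \sum_(1 <= h < H.+2) m <=
    \sum_(1 <= h < H.+2) (normc (correlation z (fun=> 1) M h) + e / 2).
  exact: ler_sum_nat.
rewrite big_split/= !sumr_const_nat subn1/= -[m *+ _]mulr_natl -[e / 2 *+ _]mulr_natl => mS.
rewrite -(ler_pM2l H0'); apply: le_trans mS _; rewrite [e in leRHS]splitr mulrDr lerD2r.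
exact: aH.
Unshelve. all: by end_near. Qed.

End van_der_Corput.

(** * Fejer weights on a grid *)

Section fejer_weights.
Context {R : realType} {d : nat}.
Implicit Types (L : nat) (u t : 'rV[R]_d) (tau : 'I_d -> int).

Definition dirichlet L t : R[i] :=
  \sum_(al : {ffun 'I_d -> 'I_L}) char (fun i => (al i)%:Z) t.

(** The normalisation makes the translates by the points of the grid of step
    [1 / (L + 1)] sum to [1]. *)
Definition fejer L t : R :=
  (L.+1 * L)%N%:R^-1 ^+ d * normc (dirichlet L t) ^+ 2.

(** The frequencies that occur in the product of the Fejer kernel with the conjugate
    of the character of frequency [tau]. *)
Definition gap L (al be : {ffun 'I_d -> 'I_L}) tau : 'I_d -> int :=
  fun i => (al i)%:Z - (be i)%:Z - tau i.

Definition unit_freq (i0 : 'I_d) : 'I_d -> int := fun i => (i == i0)%:Z.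

Lemma fejer_ge0 L t : 0 <= fejer L t.
Proof. by rewrite mulr_ge0 ?sqr_ge0// exprn_ge0// invr_ge0. Qed.

Lemma fejerM_char L t tau : (fejer L t)%:C * conjc (char tau t) =
  (L.+1 * L)%N%:R^-1 ^+ d *
  \sum_(al : {ffun 'I_d -> 'I_L}) \sum_(be : {ffun 'I_d -> 'I_L}) char (gap al be tau) t.
Proof.
rewrite /fejer rmorphM/= rmorphXn/= fmorphV/= rmorph_nat normc_sqr -[LHS]mulrA; congr (_ * _).
rewrite /dirichlet conjc_sum big_distrlr/= mulr_suml; apply: eq_bigr => al _.
by rewrite mulr_suml; apply: eq_bigr => be _; rewrite /gap !charM.
Qed.

(** Summing over the grid keeps exactly the frequencies that vanish: all those
    that occur are smaller than the number of grid points. *)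
Lemma sum_fejerM_char L tau u : (forall i, `|tau i| <= 1)%N ->
  \sum_(j : {ffun 'I_d -> 'I_L.+1})
    (fejer L (u - grid_pt j))%:C * conjc (char tau (u - grid_pt j)) =
  (L%:R^-1 ^+ d) * \sum_(al : {ffun 'I_d -> 'I_L}) \sum_(be : {ffun 'I_d -> 'I_L})
     ([forall i, gap al be tau i == 0] : nat)%:R.
Proof.
move=> tau1; under eq_bigr do rewrite fejerM_char.
rewrite -mulr_sumr exchange_big/= natrM invfM exprMn -mulrA mulrCA; congr (_ * _).
rewrite mulr_sumr; apply: eq_bigr => al _.
rewrite exchange_big/= mulr_sumr; apply: eq_bigr => be _.
have [/forallP gap0|] := boolP [forall i, gap al be tau i == 0].
  rewrite (eq_bigr (fun=> 1)) => [|j _]; last by apply: char_trivial => i; exact/eqP.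
  by rewrite sumr_const card_cells natrX exprVn mulVf// expf_neq0// pnatr_eq0.
rewrite negb_forall => /existsP[i gi].
under eq_bigr => j _ do rewrite charB.
rewrite -mulr_sumr -conjc_sum sum_char_grid ?conjc0 ?mulr0//.
exists i => //; rewrite ltnS /gap.
have := tau1 i; have := ltn_ord (al i); have := ltn_ord (be i).
lia.
Qed.

Lemma sum_fejer L u : (0 < L)%N ->
  \sum_(j : {ffun 'I_d -> 'I_L.+1}) fejer L (u - grid_pt j) = 1.
Proof.
move=> L0; apply: complexI; rewrite rmorph_sum/=.
rewrite (eq_bigr (fun j => (fejer L (u - grid_pt j))%:C *
    conjc (char (fun=> 0) (u - grid_pt j)))) => [|j _]; last first.
  by rewrite char_trivial// conjc1 mulr1.
rewrite sum_fejerM_char//.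
under eq_bigr => al _.
  rewrite (bigD1 al)//= big1 ?addr0; last first.
    move=> be ne; case: forallP => // eq0; case/eqP: ne; apply/ffunP => i.
    apply/val_inj; have /eqP := eq0 i; rewrite /gap/=; lia.
  rewrite (_ : [forall i, _]); last by apply/forallP => i; rewrite /gap subrr subr0.
  over.
rewrite sumr_const card_cells natrX -exprMn mulVf ?expr1n//.
by rewrite pnatr_eq0 -lt0n.
Qed.

(** Translating the cube of frequencies by one in a single direction leaves a
    proportion [1 - 1 / L] of it inside, and this proportion is the mean of the cosine
    under the weights; a weighted mean of [1 - cos] this small forces concentration. *)
Lemma sum_fejer_cos L u i0 : (0 < L)%N ->
  \sum_(j : {ffun 'I_d -> 'I_L.+1})
    fejer L (u - grid_pt j) * (1 - cos (2 * pi * (u ord0 i0 - grid_pt j ord0 i0)))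
  <= L%:R^-1.
Proof.
move=> L0; under eq_bigr do rewrite mulrBr mulr1.
rewrite sumrB sum_fejer// lerBlDr -lerBlDl.
have tau1 i : (`|unit_freq i0 i| <= 1)%N by rewrite /unit_freq; case: (i == i0).
have := sum_fejerM_char L u tau1 => /(congr1 (@complex.Re R)).
rewrite Re_sum; under eq_bigr => j _.
  have -> : complex.Re ((fejer L (u - grid_pt j))%:C *
      conjc (char (unit_freq i0) (u - grid_pt j))) =
    fejer L (u - grid_pt j) * cos (2 * pi * (u ord0 i0 - grid_pt j ord0 i0)).
    rewrite /char (bigD1 i0)//= big1 ?addr0 => [|i /negbTE ii0]; last first.
      by rewrite /unit_freq ii0 mul0r.
    by rewrite /unit_freq eqxx mul1r !mxE mul0r subr0.
  over.
move=> ->.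
pose S := \sum_(al : {ffun 'I_d -> 'I_L}) \sum_(be : {ffun 'I_d -> 'I_L})
     ([forall i, gap al be (unit_freq i0) i == 0] : nat).
have -> : complex.Re (L%:R^-1 ^+ d *
    (\sum_(al : {ffun 'I_d -> 'I_L}) \sum_(be : {ffun 'I_d -> 'I_L})
     ([forall i, gap al be (unit_freq i0) i == 0] : nat)%:R)) = L%:R^-1 ^+ d * S%:R :> R.
  rewrite -[RHS]/(complex.Re (_%:C)); congr complex.Re.
  rewrite rmorphM/= rmorphXn/= fmorphV/= !rmorph_nat; congr (_ * _).
  by rewrite /S natr_sum; apply: eq_bigr => al _; rewrite natr_sum.
have : ((L - 1) * L ^ d.-1 <= S)%N.
  (* [F] describes the frequencies [be] whose translate [al] by one in direction [i0]
     is again in range. *)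
  pose F (i : 'I_d) : pred 'I_L := if i == i0 then [pred a : 'I_L | a.+1 < L]%N else predT.
  have cF : #|family F| = ((L - 1) * L ^ d.-1)%N.
    rewrite card_family foldrE big_image/= (bigD1 i0)//=; congr (_ * _)%N.
      rewrite {1}/F eqxx; case: L L0 {tau1 S F} => // L _; rewrite -sum1_card.
      rewrite big_mkcond big_ord_recr/= inE/= ltnn addn0 subn1/=.
      rewrite -[RHS](card_ord L) -sum1_card; apply: eq_bigr => a _.
      by rewrite inE/= ltnS ltn_ord.
    rewrite (eq_bigr (fun=> L)); last by move=> i /negbTE ii0; rewrite /F ii0 card_ord.
    by rewrite prod_nat_const cardC1 card_ord.
  rewrite -cF -sum1_card /S exchange_big/= [leqLHS]big_mkcond/=; apply: leq_sum => be _.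
  case: ifP => // /familyP beF.
  have b0 : ((be i0).+1 < L)%N by have := beF i0; rewrite /F eqxx inE.
  pose al : {ffun 'I_d -> 'I_L} := [ffun i => if i == i0 then Ordinal b0 else be i].
  rewrite (bigD1 al)//= (_ : [forall i, _]) ?leq_addr//.
  apply/forallP => i; rewrite /gap /unit_freq /al ffunE; case: (i =P i0) => [->|_] /=.
    by rewrite -addn1 PoszD; apply/eqP; ring.
  by rewrite subrr subr0.
rewrite -(ler_nat R) => SE.
apply: (@le_trans _ _ (L%:R^-1 ^+ d * ((L - 1) * L ^ d.-1)%N%:R)); last first.
  by rewrite ler_wpM2l// exprn_ge0// invr_ge0.
have d0 : (0 < d)%N by exact: leq_ltn_trans (ltn_ord i0).
have L0' : L%:R != 0 :> R by rewrite pnatr_eq0 -lt0n.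
rewrite natrM natrB// natrX -{1}(prednK d0) exprS exprVn.
rewrite le_eqVlt; apply/orP; left; apply/eqP.
by field; rewrite expf_neq0.
Qed.

End fejer_weights.

(** * Approximating a continuous function on the cube by a trigonometric polynomial *)

Section approximation.
Context {R : realType} {d : nat}.
Implicit Types (u v : 'rV[R]_d) (L : nat).

(** A one-variable Fejer kernel normalised to have maximum [1]: it is bounded below
    near the integers while its mean is only [1 / L]. *)
Definition bump L (t : R) : R :=
  (L%:R^-1 * normc (\sum_(a < L) cis (2 * pi * (a%:R * t)))) ^+ 2.

Lemma bump_ge0 L t : 0 <= bump L t.
Proof. exact: sqr_ge0. Qed.

Lemma bump_sub1 L t : bump L (t - 1) = bump L t.
Proof.
rewrite /bump; congr ((_ * normc _) ^+ 2); apply: eq_bigr => a _.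
rewrite !mulrBr mulr1 cisD cisN [_ * _ * a%:R](_ : _ = 2 * pi * (a : int)%:~R)//.
by rewrite cis_int conjc1 mulr1.
Qed.

Lemma bump_near0 L : (0 < L)%N ->
  exists2 r : R, 0 < r & forall t, `|t| < r -> 2^-1 <= bump L t.
Proof.
move=> L0; have L0' : 0 < L%:R :> R by rewrite ltr0n.
have [r r0 rP] : exists2 r : R, 0 < r & forall t, `|t| < r -> normc (cis t - 1) <= 4^-1.
  by apply: cis_near1; rewrite invr_gt0.
have C0 : 0 < 2 * pi * L%:R :> R by rewrite !mulr_gt0 ?pi_gt0.
exists (r / (2 * pi * L%:R)); first by rewrite divr_gt0.
move=> t; rewrite ltr_pdivlMr// => tr.
rewrite /bump; set S := \sum_(a < L) _.
have S1 : normc (S - L%:R) <= L%:R * 4^-1.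
  have -> : S - L%:R = \sum_(a < L) (cis (2 * pi * (a%:R * t)) - 1).
    by rewrite sumrB sumr_const card_ord.
  apply: le_trans (normc_sum _ _ _) _.
  apply: (@le_trans _ _ (\sum_(a < L) 4^-1)); last first.
    by rewrite sumr_const card_ord mulr_natl.
  apply: ler_sum => a _; apply: rP; apply: le_lt_trans tr.
  rewrite !normrM (ger0_norm (pi_ge0 R)) !normr_nat.
  have -> : `|t| * (2 * pi * L%:R) = 2 * pi * (L%:R * `|t|) by ring.
  rewrite ler_pM2l ?mulr_gt0 ?pi_gt0//.
  by rewrite ler_wpM2r// ler_nat ltnW.
have : L%:R - normc S <= normc (S - L%:R).
  by apply: le_trans (ler_norm _) _; rewrite -{1}normc_nat (le_trans (normc_dist _ _))// normcB.
move=> S2; have S3 : 3 / 4 <= L%:R^-1 * normc S.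
  by rewrite ler_pdivlMl//; lra.
by rewrite expr2; nra.
Qed.

Lemma bumpE L u i : (bump L (u ord0 i))%:C = L%:R^-1 ^+ 2 *
  \sum_(a < L) \sum_(b < L) char (fun i' => (a%:Z - b%:Z) * unit_freq i i') u.
Proof.
rewrite /bump exprMn rmorphM/= rmorphXn/= fmorphV/= rmorph_nat normc_sqr; congr (_ * _).
rewrite conjc_sum big_distrlr; apply: eq_bigr => a _; apply: eq_bigr => b _.
rewrite -cisN [LHS](esym (cisD _ _)) /char -mulrBr; congr (cis (_ * _)).
rewrite (bigD1 i)//= big1 ?addr0 => [|i' /negbTE ii]; last first.
  by rewrite /unit_freq ii mulr0 mul0r.
by rewrite /unit_freq eqxx mulr1 rmorphB/= mulrBl.
Qed.

Lemma cos_mid_le (r s : R) : 0 < r < 2^-1 -> r <= s <= 1 - r ->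
  cos (2 * pi * s) <= cos (2 * pi * r).
Proof.
move=> /andP[r0 r1] /andP[rs sr]; have p0 := pi_gt0 R.
have half (t : R) : r <= t <= 2^-1 -> cos (2 * pi * t) <= cos (2 * pi * r).
  rewrite le_eqVlt => /andP[/predU1P[->//|rt] t1]; apply: ltW; rewrite ltr_cos.
  - by rewrite ltr_pM2l ?mulr_gt0.
  - by rewrite in_itv/=; apply/andP; split; nra.
  - by rewrite in_itv/=; apply/andP; split; nra.
have [s1|s1] := leP s 2^-1; first by rewrite half// rs.
have -> : cos (2 * pi * s) = cos (2 * pi * (1 - s)).
  rewrite mulrBr mulr1 -[RHS]cosN opprB -(cosD2pi (2 * pi * s - 2 * pi)).
  by congr cos; ring.
by rewrite half//; apply/andP; split; lra.
Qed.

(** Away from the boundary, points whose distance modulo [1] is small are close;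
    near the boundary this fails since [f] need not be periodic, and the bump
    takes over: it is at least [1 / 2] there, and [f] oscillates by at most [2 B]. *)
Lemma oscillation_le (f : 'rV[R]_d -> R[i]) (B e : R) L :
  {within unit_cube d, continuous f} ->
  (forall u, unit_cube d u -> normc (f u) <= B) -> 0 < e -> (0 < L)%N ->
  exists2 C : R, 0 <= C & forall u v, unit_cube d u -> unit_cube d v ->
    normc (f u - f v) <= e + C * (\sum_i (1 - cos (2 * pi * (u ord0 i - v ord0 i))))
                           + 4 * B * \sum_i bump L (u ord0 i).
Proof.
move=> cf fB e0 L0; have [r1 r10 r1P] := bump_near0 L0.
have [r2 r20 r2P] := unif_continuous_cube cf e0.
(* With [r] at most [1 / 4], the cosine is decreasing on the arc up to [2 pi r]. *)
pose r := Num.min (Num.min r1 r2) 4^-1.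
have r0 : 0 < r by rewrite !lt_min r10 r20/= invr_gt0.
have rr1 : r <= r1 by rewrite !ge_min lexx.
have rr2 : r <= r2 by rewrite !ge_min lexx orbT.
have r4 : r <= 4^-1 by rewrite ge_min lexx orbT.
have p0 := pi_gt0 R.
pose c := 1 - cos (2 * pi * r).
have c0 : 0 < c.
  rewrite subr_gt0 -[ltRHS]cos0 ltr_cos ?mulr_gt0//.
  - by rewrite in_itv/= lexx ltW.
  - by rewrite in_itv/=; apply/andP; split; nra.
have cos_ge0 (t : R) : 0 <= 1 - cos t by rewrite subr_ge0 cos_le1.
exists (2 * `|B| / c); first by rewrite divr_ge0 ?mulr_ge0// ltW.
move=> u v uc vc; have B0 : 0 <= B by apply: le_trans (normc_ge0 _) (fB u uc).
rewrite (ger0_norm B0); have f2B : normc (f u - f v) <= 2 * B.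
  by apply: le_trans (normcB_le _ _) _; rewrite mulr_natl mulr2n lerD// fB.
have sb0 : 0 <= \sum_i bump L (u ord0 i) by rewrite sumr_ge0// => i _; exact: bump_ge0.
have sc0 : 0 <= \sum_i (1 - cos (2 * pi * (u ord0 i - v ord0 i))).
  by rewrite sumr_ge0.
have C0 : 0 <= 2 * B / c by rewrite divr_ge0 ?mulr_ge0// ltW.
have [/existsP[i ui]|/existsPn inner] := boolP [exists i, (u ord0 i < r) || (1 - r < u ord0 i)].
  have bi : 2^-1 <= bump L (u ord0 i).
    have /andP[u0 u1] := uc i; case/orP: ui => ui.
      by apply: r1P; rewrite ger0_norm// (lt_le_trans ui).
    by rewrite -bump_sub1; apply: r1P; rewrite ler0_norm; lra.
  have : 2^-1 <= \sum_i bump L (u ord0 i).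
    rewrite (bigD1 i)//=; apply: (le_trans bi); rewrite lerDl sumr_ge0// => k _.
    exact: bump_ge0.
  move=> sb; apply: (le_trans f2B); have := mulr_ge0 C0 sc0; nra.
have sB : 0 <= 4 * B * \sum_i bump L (u ord0 i) by rewrite !mulr_ge0.
have [/forallP uv|] := boolP [forall i, `|u ord0 i - v ord0 i| < r].
  have := r2P u v uc vc (fun i => lt_le_trans (uv i) rr2).
  have := mulr_ge0 C0 sc0; lra.
rewrite negb_forall => /existsP[i ri]; rewrite -leNgt in ri.
have si : c <= \sum_i (1 - cos (2 * pi * (u ord0 i - v ord0 i))).
  rewrite (bigD1 i)//= -[leLHS]addr0 lerD ?sumr_ge0// lerD2l lerN2.
  have -> : cos (2 * pi * (u ord0 i - v ord0 i)) = cos (2 * pi * `|u ord0 i - v ord0 i|).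
    by case: ger0P => // _; rewrite mulrN cosN.
  apply: cos_mid_le; first by rewrite r0/=; lra.
  rewrite ri/=; have := inner i; rewrite negb_or -!leNgt => /andP[u0 u1].
  have /andP[v0 v1] := vc i; rewrite ler_norml; apply/andP; split; lra.
apply: (le_trans f2B).
have : 2 * B <= 2 * B / c * \sum_i (1 - cos (2 * pi * (u ord0 i - v ord0 i))).
  by rewrite -mulrA ler_peMr ?mulr_ge0// ler_pdivlMl// mulr1.
lra.
Qed.

Definition fejer_mean L (f : 'rV[R]_d -> R[i]) u : R[i] :=
  \sum_(j : {ffun 'I_d -> 'I_L.+1}) (fejer L (u - grid_pt j))%:C * f (grid_pt j).

(** The Fejer weights around [u] have total mass [1] and are concentrated near [u]
    modulo [1], so averaging the oscillation bound over them costs [C d / L]. *)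
Lemma fejer_mean_approx (f : 'rV[R]_d -> R[i]) (B e C : R) L K :
  (0 < K)%N -> 0 <= C ->
  (forall u v, unit_cube d u -> unit_cube d v ->
    normc (f u - f v) <= e + C * (\sum_i (1 - cos (2 * pi * (u ord0 i - v ord0 i))))
                           + 4 * B * \sum_i bump L (u ord0 i)) ->
  forall u, unit_cube d u ->
  normc (f u - fejer_mean K f u) <=
    e + C * (d%:R / K%:R) + 4 * B * \sum_i bump L (u ord0 i).
Proof.
move=> K0 C0 osc u uc; set b := 4 * B * _.
have -> : f u - fejer_mean K f u = \sum_(j : {ffun 'I_d -> 'I_K.+1})
    (fejer K (u - grid_pt j))%:C * (f u - f (grid_pt j)).
  under eq_bigr do rewrite mulrBr.
  by rewrite sumrB -mulr_suml -rmorph_sum/= sum_fejer// mul1r.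
apply: le_trans (normc_sum _ _ _) _.
pose s (j : {ffun 'I_d -> 'I_K.+1}) : R :=
  \sum_i (1 - cos (2 * pi * (u ord0 i - grid_pt j ord0 i))).
apply: (@le_trans _ _ (\sum_(j : {ffun 'I_d -> 'I_K.+1})
    fejer K (u - grid_pt j) * ((e + b) + C * s j))).
  apply: ler_sum => j _; rewrite ComplexField.Normc.normcM normc_real.
  rewrite ger0_norm ?fejer_ge0// ler_wpM2l ?fejer_ge0// addrAC.
  by apply: osc => //; exact: grid_pt_cube.
under eq_bigr do rewrite mulrDr.
rewrite big_split/= -mulr_suml sum_fejer// mul1r addrAC lerD2r lerD2l.
under eq_bigr do rewrite mulrCA.
rewrite -mulr_sumr ler_wpM2l// /s.
under eq_bigr do rewrite mulr_sumr.
rewrite exchange_big/=.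
apply: (@le_trans _ _ (\sum_(i < d) K%:R^-1)).
  by apply: ler_sum => i _; exact: sum_fejer_cos.
by rewrite sumr_const card_ord mulr_natl.
Qed.

End approximation.

(** * Sequences with equidistributed differences *)

Section sequence.
Context {R : realType} {d : nat} (x : nat -> 'rV[R]_d)
  (hx : forall n, (0 < n)%N -> unit_cube d (x n))
  (hD : (fun H : nat => H%:R^-1 * \sum_(1 <= h < H.+1)
    upper_discrepancy (fun n => sub_mod1 (x (n + h)%N) (x n))) @ \oo --> (0 : R)).

Let diff h n : 'rV[R]_d := sub_mod1 (x (n + h)%N) (x n).

Lemma sub_mod1_cube (u v : 'rV[R]_d) : unit_cube d (sub_mod1 u v).
Proof.
move=> i; rewrite mxE /frac_part subr_ge0 floor_le /=.
by rewrite lerBlDr [1 + _]addrC; apply/ltW; rewrite -intrD1 floorD1_gt.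
Qed.

Lemma char_correlation k h M :
  correlation (fun n => char k (x n)) (fun n => char k (x n)) M h =
  M%:R^-1 * \sum_(1 <= n < M.+1) char k (diff h n).
Proof.
by congr (_ * _); apply: eq_bigr => n _; rewrite /diff char_sub_mod1.
Qed.

(** The only place where the discrepancies enter: a character turns the correlation
    of the sequence with its shift into an average over the differences. *)
Lemma decorrelated_char (k : 'I_d -> int) : (exists i, k i != 0) ->
  decorrelated (fun n => char k (x n)).
Proof.
move=> k0; apply: decorrelated_of_self => [n|e e0]; first by rewrite normc_char.
have e30 : 0 < e / 3 by rewrite divr_gt0.
have [C C0 CP] := char_average_le k0 e30.
have C1 : 0 < 3 * (C + 1) by rewrite mulr_gt0// ltr_wpDl.
pose b := e / (3 * (C + 1)); have b0 : 0 < b by rewrite divr_gt0.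
have Cb : C * b <= e / 3.
  by rewrite /b invfM mulrCA !mulrA ler_pdivrMr ?ltr_wpDl//; nra.
near=> H.
have H0 : 0 < H%:R :> R by rewrite ltr0n; near: H; exact: nbhs_infty_gt.
have avg : H%:R^-1 * \sum_(1 <= h < H.+1) upper_discrepancy (diff h) <= b.
  apply: ltW; near: H; exact: (cvgr_lt _ hD).
near=> M.
have M0 : (0 < M)%N by near: M; exact: nbhs_infty_gt.
have dM (h : 'I_H.+1) : discrepancy (diff h) M <= upper_discrepancy (diff h) + b.
  move: h; near: M; apply: filter_forall => h; exact: le_upper_discrepancy.
rewrite /averaged_correlation ler_pdivrMl//.
rewrite ler_pdivrMl// in avg.
apply: (@le_trans _ _ (\sum_(1 <= h < H.+1)
    (e / 3 + C * (upper_discrepancy (diff h) + b)))).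
  apply: ler_sum_nat => h /andP[_ hH]; rewrite char_correlation.
  apply: le_trans (CP _ M _ M0) _; first by move=> n _; exact: sub_mod1_cube.
  by rewrite lerD2l ler_wpM2l//; exact: (dM (Ordinal hH)).
rewrite big_split/= -[X in _ + X]mulr_sumr big_split/= !sumr_const_nat subn1/=.
rewrite -[e / 3 *+ H]mulr_natl -[b *+ H]mulr_natl.
have := ler_wpM2l C0 avg; rewrite mulrDr => avg'.
have := ler_wpM2l (ltW H0) Cb.
move: avg'; set S := \sum_(1 <= h < _) _.
nra.
Unshelve. all: by end_near. Qed.

Lemma mean_char (k : 'I_d -> int) : (exists i, k i != 0) -> forall e : R, 0 < e ->
  \forall M \near \oo, normc (M%:R^-1 * \sum_(1 <= n < M.+1) char k (x n)) <= e.
Proof.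
move=> k0; apply: decorrelated_mean; last exact: decorrelated_char.
by move=> n; rewrite normc_char.
Qed.

(** Expanding the bump into characters, only the [L] diagonal terms among the [L ^ 2]
    survive averaging: the sequence does not accumulate at the boundary. *)
Lemma mean_bump L i (e : R) : (0 < L)%N -> 0 < e ->
  \forall M \near \oo,
    M%:R^-1 * (\sum_(1 <= n < M.+1) bump L (x n ord0 i)) <= L%:R^-1 + e.
Proof.
move=> L0 e0; have L0' : 0 < L%:R :> R by rewrite ltr0n.
pose k (a b : 'I_L) : 'I_d -> int := fun i' => (a%:Z - b%:Z) * unit_freq i i'.
near=> M; have M0 : M%:R != 0 :> R by rewrite pnatr_eq0 -lt0n; near: M; exact: nbhs_infty_gt.
have kM (ab : 'I_L * 'I_L) : normc (M%:R^-1 * \sum_(1 <= n < M.+1) char (k ab.1 ab.2) (x n))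
    <= (ab.1 == ab.2)%:R + e.
  move: ab; near: M; apply: filter_forall => -[a b] /=.
  have [->|ab] := eqVneq a b.
    near=> M; rewrite (eq_bigr (fun=> 1)) => [|n _]; last first.
      by apply: char_trivial => i'; rewrite /k subrr mul0r.
    rewrite sumr_const_nat subn1/= mulVf ?ComplexField.Normc.normc1 ?lerDl ?ltW//.
    by rewrite pnatr_eq0 -lt0n; near: M; exact: nbhs_infty_gt.
  rewrite add0r; apply: mean_char => //; exists i.
  rewrite /k /unit_freq eqxx mulr1 subr_eq0; apply: contra ab => /eqP[ab].
  exact/eqP/val_inj.
have bE : M%:R^-1 * (\sum_(1 <= n < M.+1) bump L (x n ord0 i)) =
   normc (L%:R^-1 ^+ 2 * \sum_(a < L) \sum_(b < L)
     (M%:R^-1 * \sum_(1 <= n < M.+1) char (k a b) (x n))).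
  rewrite -[LHS]ger0_norm; last first.
    by rewrite mulr_ge0 ?invr_ge0// sumr_ge0// => n _; exact: bump_ge0.
  rewrite -normc_real; congr normc; rewrite rmorphM/= fmorphV/= rmorph_nat rmorph_sum/=.
  under eq_bigr do rewrite bumpE.
  rewrite -mulr_sumr mulrCA; congr (_ * _).
  rewrite exchange_big mulr_sumr; apply: eq_bigr => a _.
  by rewrite exchange_big mulr_sumr; apply: eq_bigr => b _.
rewrite bE ComplexField.Normc.normcM exprVn -natrX ComplexField.Normc.normcV normc_nat.
rewrite ler_pdivrMl ?ltr0n ?expn_gt0 ?L0//.
apply: le_trans (normc_sum _ _ _) _.
apply: (@le_trans _ _ (\sum_(a < L) \sum_(b < L) ((a == b)%:R + e))).
  apply: ler_sum => a _; apply: le_trans (normc_sum _ _ _) _.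
  by apply: ler_sum => b _; exact: (kM (a, b)).
rewrite (eq_bigr (fun=> 1 + L%:R * e)) => [|a _]; last first.
  rewrite big_split/= sumr_const card_ord -[e *+ L]mulr_natl; congr (_ + _).
  by rewrite (bigD1 a)//= eqxx big1 ?addr0// => b /negbTE; rewrite eq_sym => ->.
rewrite sumr_const card_ord -[X in X <= _]mulr_natl natrX le_eqVlt; apply/orP; left.
by apply/eqP; field; rewrite gt_eqF.
Unshelve. all: by end_near. Qed.

(** The subtracted constant is the contribution of the zero frequency. *)
Lemma decorrelated_fejer_mean (f : 'rV[R]_d -> R[i]) L : (0 < L)%N ->
  decorrelated (fun n => fejer_mean L f (x n) -
    L.+1%:R^-1 ^+ d * \sum_(j : {ffun 'I_d -> 'I_L.+1}) f (grid_pt j)).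
Proof.
move=> L0; pose zero : 'I_d -> int := fun=> 0.
pose cf (j : {ffun 'I_d -> 'I_L.+1}) (al be : {ffun 'I_d -> 'I_L}) : R[i] :=
  f (grid_pt j) * (L.+1 * L)%N%:R^-1 ^+ d * conjc (char (gap al be zero) (grid_pt j)).
rewrite (_ : (fun n => _) = fun n => \sum_(j : {ffun 'I_d -> 'I_L.+1})
    \sum_(al : {ffun 'I_d -> 'I_L}) \sum_(be : {ffun 'I_d -> 'I_L} | be != al)
      cf j al be * char (gap al be zero) (x n)); last first.
  apply/funext => n; rewrite /fejer_mean mulr_sumr -sumrB; apply: eq_bigr => j _.
  have := fejerM_char L (x n - grid_pt j) zero; rewrite char_trivial// conjc1 mulr1 => ->.
  have -> : L.+1%:R^-1 ^+ d * f (grid_pt j) = \sum_(al : {ffun 'I_d -> 'I_L})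
      cf j al al * char (gap al al zero) (x n).
    under eq_bigr => al _.
      have g0 i : gap al al zero i = 0 by rewrite /gap subrr subr0.
      rewrite /cf !char_trivial// conjc1 !mulr1; over.
    rewrite sumr_const card_cells -[_ *+ (L ^ d)%N]mulr_natl natrX natrM invfM exprMn.
    have LL : L%:R ^+ d * L%:R^-1 ^+ d = 1 :> R[i].
      by rewrite -exprMn mulfV ?expr1n// pnatr_eq0 -lt0n.
    by rewrite -[LHS]mulr1 -[X in _ * X = _]LL; ring.
  rewrite mulrC !mulr_sumr -sumrB; apply: eq_bigr => al _.
  rewrite !mulr_sumr (eq_bigr (fun be => cf j al be * char (gap al be zero) (x n))).
    by rewrite (bigD1 al)//= addrAC subrr add0r.
  by move=> be _; rewrite charB /cf; ring.
apply: decorrelated_sum => j _; apply: decorrelated_sum => al _.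
apply: decorrelated_sum => be ne; apply: decorrelatedZ; apply: decorrelated_char.
apply: contrapT => /forallNP eq0; case/eqP: ne; apply/ffunP => i; apply/val_inj.
have /negP := eq0 i; rewrite negbK /gap /zero /= => /eqP; lia.
Qed.

(** The trigonometric polynomial minus its constant term approximates [f] in mean:
    the constant term is a Riemann sum of [f], whose integral vanishes. *)
Lemma decorrelated_continuous (f : 'rV[R]_d -> R[i]) :
  {within unit_cube d, continuous f} -> cube_integral f = 0 ->
  decorrelated (fun n => f (x n)).
Proof.
move=> cf f0; have [B B0 fB] := bounded_on_cube cf.
apply: decorrelated_approx => e e0.
have e60 : 0 < e / 6 by rewrite divr_gt0.
have d1 : 0 < d.+1%:R :> R by rewrite ltr0n.
(* The bumps contribute at most [4 B d (1 / L + s)] on average, so at most [e / 3]. *)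
pose s := e / (24 * B * d.+1%:R); have s0 : 0 < s by rewrite divr_gt0 ?mulr_gt0.
pose L := (Num.truncn s^-1).+1.
have Ls : L%:R^-1 <= s.
  by rewrite invf_ple ?posrE ?ltr0n//; apply/ltW/truncnS_gt.
have [C C0 osc] := oscillation_le cf fB e60 (ltn0Sn _ : (0 < L)%N).
have [fRe fIm] : \int[lebesgue_rV d]_(u in unit_cube d) complex.Re (f u) = 0 /\
    \int[lebesgue_rV d]_(u in unit_cube d) complex.Im (f u) = 0.
  by move: f0; rewrite /cube_integral => /eqP; rewrite eq_complex => /andP[/eqP ? /eqP ?].
have [K [K0 KC Kc]] : exists K, [/\ (0 < K)%N, C * (d%:R / K%:R) <= e / 6 &
   normc (K.+1%:R^-1 ^+ d * \sum_(j : {ffun 'I_d -> 'I_K.+1}) f (grid_pt j)) <= e / 3].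
  apply: (@filter_ex _ \oo); near=> K; split=> //.
  - by near: K; exact: nbhs_infty_gt.
  - have K0 : 0 < K%:R :> R by rewrite ltr0n; near: K; exact: nbhs_infty_gt.
    rewrite mulrA ler_pdivrMr// -ler_pdivrMl//; apply/ltW/(lt_le_trans (truncnS_gt _)).
    by rewrite ler_nat; near: K; exact: nbhs_infty_ge.
  - set c := _ * _; have [Re0 Im0] : complex.Re c = K.+1%:R^-1 ^+ d *
        \sum_(j : {ffun 'I_d -> 'I_K.+1}) complex.Re (f (grid_pt j)) /\
      complex.Im c = K.+1%:R^-1 ^+ d *
        \sum_(j : {ffun 'I_d -> 'I_K.+1}) complex.Im (f (grid_pt j)).
      have cE : c = (K.+1%:R^-1 ^+ d)%:C * \sum_(j : {ffun 'I_d -> 'I_K.+1}) f (grid_pt j).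
        by rewrite rmorphXn/= fmorphV/= rmorph_nat.
      rewrite -Re_sum -Im_sum cE; case: (\sum_j _) => p q /=.
      by rewrite !mul0r subr0 addr0.
    apply: le_trans (normc_le_ReIm _) _; rewrite Re0 Im0.
    have -> : e / 3 = e / 6 + e / 6 by field.
    apply: lerD.
      near: K; have := riemann_sum_cvg (grid_continuous_Re cf) e60.
      by apply: filterS => K; rewrite fRe sub0r normrN.
    near: K; have := riemann_sum_cvg (grid_continuous_Im cf) e60.
    by apply: filterS => K; rewrite fIm sub0r normrN.
eexists; first exact: (decorrelated_fejer_mean f K0).
set c := _ * \sum_j f _ in Kc *.
near=> M; have M0 : 0 < M%:R :> R by rewrite ltr0n; near: M; exact: nbhs_infty_gt.
have bM (i : 'I_d) :
    M%:R^-1 * (\sum_(1 <= n < M.+1) bump L (x n ord0 i)) <= L%:R^-1 + s.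
  by move: i; near: M; apply: filter_forall => i; exact: mean_bump.
rewrite ler_pdivrMl//.
pose bs n : R := 4 * B * \sum_i bump L (x n ord0 i).
apply: (@le_trans _ _ (\sum_(1 <= n < M.+1) (e / 6 + e / 6 + e / 3 + bs n))).
  apply: ler_sum_nat => n /andP[n1 _].
  have -> : f (x n) - (fejer_mean K f (x n) - c) = (f (x n) - fejer_mean K f (x n)) + c.
    by rewrite opprB addrA addrAC.
  apply: le_trans (le_normcD _ _) _; rewrite addrAC lerD//.
  apply: le_trans (fejer_mean_approx K0 C0 osc (hx n1)) _.
  by rewrite lerD2r lerD2l.
rewrite big_split/= sumr_const_nat subn1/= -[_ *+ M]mulr_natl /bs -mulr_sumr exchange_big/=.
have sum_bM : \sum_(i < d) \sum_(1 <= n < M.+1) bump L (x n ord0 i) <=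
    d%:R * (M%:R * (2 * s)).
  apply: (@le_trans _ _ (\sum_(i < d) (M%:R * (2 * s)))).
    apply: ler_sum => i _; have := bM i; rewrite ler_pdivrMl// => h; apply: le_trans h _.
    by rewrite ler_pM2l//; lra.
  by rewrite sumr_const card_ord -[X in X <= _]mulr_natl.
have B4 : 0 <= 4 * B by rewrite mulr_ge0// ltW.
have -> : M%:R * e = M%:R * (e / 6 + e / 6 + e / 3) + 4 * B * (d.+1%:R * (M%:R * (2 * s))).
  rewrite /s; move: (d.+1%:R : R) d1 => D D0.
  by field; rewrite (gt_eqF B0) (gt_eqF D0).
rewrite lerD2l ler_wpM2l//; apply: le_trans sum_bM _.
apply: ler_wpM2r; last by rewrite ler_nat.
exact: mulr_ge0 (ltW M0) (mulr_ge0 (ler0n _ 2) (ltW s0)).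
Unshelve. all: by end_near. Qed.

End sequence.

(** * From averaged correlations to near weak mixing *)

Section near_weak_mixing.
Context {R : realType}.
Implicit Types (z y : nat -> R[i]).

Lemma bounded_fun_normc z :
  bounded_fun z <-> exists B : R, forall n, normc (z n) <= B.
Proof.
split=> [[b [_ zb]]|[B zB]].
  exists (complex.Re (b + 1)) => n.
  have : `|z n| <= b + 1 by apply: zb => //; rewrite ltrDl.
  by rewrite -normcE lecE => /andP[].
exists B%:C; split; first by apply/complex_realP; exists B.
move=> b Bb n _ /=; apply: le_trans (ltW Bb).
by rewrite -normcE lecR.
Qed.

Lemma averaged_correlationZr (a : R) z y M H : 0 <= a ->
  averaged_correlation z (fun n => a%:C * y n) M H = a * averaged_correlation z y M H.
Proof.
move=> a0; rewrite /averaged_correlation [RHS]mulrCA [in RHS]mulr_sumr; congr (_ * _).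
apply: eq_bigr => h _; rewrite -[in RHS](ger0_norm a0) -normc_real.
rewrite -ComplexField.Normc.normcM; congr normc.
rewrite /correlation [RHS]mulrCA [in RHS]mulr_sumr; congr (_ * _).
have conjcZ (w : R[i]) : conjc (a%:C * w) = a%:C * conjc w.
  by rewrite -[in RHS]conjc_real; exact: rmorphM.
by apply: eq_bigr => n _; rewrite conjcZ mulrCA.
Qed.

Lemma decorrelated_bounded z y (B : R) : decorrelated z ->
  (forall n, normc (y n) <= B) -> forall e : R, 0 < e ->
  \forall H \near \oo, \forall M \near \oo, averaged_correlation z y M H <= e.
Proof.
move=> dz yB e e0; have B1 : 0 < B + 1.
  by rewrite ltr_wpDl// (le_trans (normc_ge0 (y 0%N))).
pose c := (B + 1)^-1; have c0 : 0 <= c by rewrite invr_ge0 ltW.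
have cB : c * (B + 1) = 1 by rewrite mulVf// gt_eqF.
have y1 n : normc (c%:C * y n) <= 1.
  rewrite ComplexField.Normc.normcM normc_real ger0_norm// -cB ler_wpM2l//.
  by rewrite (le_trans (yB n))// lerDl.
have := dz _ y1 _ (divr_gt0 e0 B1); apply: filterS => H; apply: filterS => M.
by rewrite averaged_correlationZr// [leRHS]mulrC ler_pM2l// invr_gt0.
Qed.

Lemma cvg_normc (u : nat -> R[i]) : cvgn u -> cvgn (fun q => normc (u q)).
Proof.
move=> /cvg_ex[l ul]; apply/cvg_ex; exists (normc l).
apply/cvgrPdist_lt => e e0; move: ul => /cvgrPdist_lt/(_ e%:C).
rewrite ltcR => /(_ e0); apply: filterS => q; rewrite -normcE ltcR.
exact: le_lt_trans (normc_dist _ _).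
Qed.

(** Along a permissible sequence of lengths the average over the shifts commutes
    with the limit, a finite sum of convergent sequences. *)
Lemma nearly_weakly_mixing_decorrelated z :
  bounded_fun z -> decorrelated z -> nearly_weakly_mixing z.
Proof.
move=> bz dz; split=> // y N [_ /bounded_fun_normc[B yB] N0 Nincr cv].
pose c h q := normc (correlation z y (N q) h).
have cc h : cvgn (c h) by apply: cvg_normc; apply: cv; [left|right].
have Nge q : (q <= N q)%N.
  by elim: q => // q ih; exact: leq_ltn_trans ih (Nincr _ _ (ltnSn q)).
have avgE H : (fun q => averaged_correlation z y (N q) H) @ \oo -->
    H%:R^-1 * \sum_(1 <= h < H.+1) limn (c h).
  apply: cvgMr; apply: cvg_big => [|h _]; [exact: add_continuous|exact: cc].
apply/cvgr0Pnorm_le => e e0; have := decorrelated_bounded dz yB e0.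
apply: filterS => H [M0 _ HM]; rewrite -/(c _) ger0_norm.
  apply: (cvgr_to_le (avgE H)); exists M0 => // q /= M0q.
  by apply: HM; exact: leq_trans M0q (Nge q).
rewrite mulr_ge0 ?invr_ge0// sumr_ge0// => h _; apply: limr_ge; first exact: cc.
by apply: nearW => q; exact: normc_ge0.
Qed.

End near_weak_mixing.

Theorem theorem3p3 (R : realType) (d : nat) (hd : (0 < d)%N)
    (x : nat -> 'rV[R]_d)
    (hx : forall n, (0 < n)%N -> unit_cube d (x n))
    (hD : (fun H : nat => H%:R^-1 * \sum_(1 <= h < H.+1)
             upper_discrepancy (fun n => sub_mod1 (x (n + h)%N) (x n)))
          @ \oo --> (0 : R)) :
  wm_sequence x.
Proof.
split=> // f cf f0; apply: nearly_weakly_mixing_decorrelated; last first.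
  exact: decorrelated_continuous.
have [B _ fB] := bounded_on_cube cf.
apply/bounded_fun_normc; exists (normc (f (x 0%N)) + B) => -[|n].
  by rewrite lerDl (le_trans (normc_ge0 _) (fB _ (hx _ (ltn0Sn 0)))).
by apply: le_trans (fB _ (hx _ (ltn0Sn n))) _; rewrite lerDr normc_ge0.
Qed.
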